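(* Let $\mathcal{G}$ be a 5-dimensional Lie group admitting a left-invariant structure $(\varphi,\xi,\eta,g)$ (all four tensors left-invariant) which makes $\mathcal{G}$ a hyperbolic or elliptic weakly para-cosymplectic manifold with para-K\''ahler leaves. Then $\mathcal{G}$ belongs to one of the classes $\mathcal{G}_1,\mathcal{G}_2,\mathcal{G}_3,\mathcal{G}_4$, where a Lie group belongs to $\mathcal{G}_i$ if its Lie algebra has a basis $(\xi,V_1,V_2,V_3,V_4)$ whose brackets (those not listed being zero, up to antisymmetry) are as follows for some $\sigma=\pm1$ and real constants: $\mathcal{G}_1$ (constants $\alpha_1\neq0$, $\alpha_2\neq0$, $\beta_1,\beta_2$): $[\xi,V_3]=V_1+\sigma\frac{\alpha_1}{\alpha_2}V_2$, $[V_1,V_3]=-\alpha_1V_1$, $[V_2,V_3]=-\alpha_1V_2$, $[\xi,V_4]=-\sigma\frac{\alpha_1}{\alpha_2}V_1+\sigma V_2$, $[V_2,V_4]=\alpha_1V_1-\alpha_2V_2$, $[V_3,V_4]=-\beta_1V_1-\beta_2V_2$; $\mathcal{G}_2$ (constants $\alpha_1\neq0$, $\alpha_2\neq0$, $\beta_1,\beta_2$): $[\xi,V_3]=V_1-\frac{\alpha_2}{\alpha_1}V_2$, $[V_1,V_3]=-\alpha_1V_1+\alpha_2V_2$, $[V_3,V_4]=-\beta_1V_1-\beta_2V_2$, $[\xi,V_4]=\frac{\alpha_2}{\alpha_1}V_1+\sigma V_2$, $[V_1,V_4]=-\alpha_2V_1$, $[V_2,V_4]=-\alpha_2V_2$;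 $\mathcal{G}_3$ (arbitrary constants $\alpha_1,\alpha_2,\beta_1,\beta_2$): $[\xi,V_3]=V_1$, $[V_1,V_3]=-\alpha_1V_1$, $[\xi,V_4]=\sigma V_2$, $[V_2,V_4]=-\alpha_2V_2$, $[V_3,V_4]=-\beta_1V_1-\beta_2V_2$; $\mathcal{G}_4$ (constants $\alpha_0\neq0$, $\beta_1,\beta_2$): $[\xi,V_3]=V_1+\alpha_0V_2$, $[\xi,V_4]=-\alpha_0V_1+\sigma V_2$, $[V_3,V_4]=-\beta_1V_1-\beta_2V_2$.
   Context: An almost para-contact metric structure on $\mathcal{M}$, $\dim\mathcal{M}=2n+1$, is a quadruple $(\varphi,\xi,\eta,g)$ ($\varphi$ a $(1,1)$-tensor field, $\xi$ a vector field, $\eta$ a 1-form, $g$ a pseudo-Riemannian metric) with $\varphi^2=Id-\eta\otimes\xi$, $\eta(\xi)=1$, $g(\varphi X,\varphi Y)=-g(X,Y)+\eta(X)\eta(Y)$, $\eta(X)=g(\xi,X)$. With $\varPhi(X,Y)=g(\varphi X,Y)$, the manifold is almost para-cosymplectic if $d\eta=0$ and $d\varPhi=0$; it is then weakly para-cosymplectic if $R(X,Y)\varphi Z=\varphi R(X,Y)Z$ for all $X,Y,Z$, where $R(X,Y)Z=\nabla_X\nabla_YZ-\nabla_Y\nabla_XZ-\nabla_{[X,Y]}Z$ and $\nabla$ is the Levi-Civita connection. Put $AX=-\nabla_X\xi$. Each leaf of the foliation $\eta=0$ inherits an almost para-Hermitian structure $(P,H)$ by restricting $\varphi$ and $g$;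 the manifold has para-K\''ahler leaves if $P$ is parallel for the Levi-Civita connection of $H$ on every leaf, equivalently $(\nabla_X\varphi)Y=g(A\varphi X,Y)\xi-\eta(Y)A\varphi X$. Elliptic/hyperbolic (dimension 5): near each point there are smooth nowhere zero vector fields $V_1,V_2$ (unique up to sign) with $\varphi V_1=-V_1$, $\varphi V_2=V_2$, $g(V_1,V_2)=0$ and $AX=\varepsilon\left(g(X,V_1)V_1+\sigma g(X,V_2)V_2\right)$, $\varepsilon=\pm1$, where $\sigma=1$ in the elliptic and $\sigma=-1$ in the hyperbolic case; replacing $(\xi,\eta)$ by $(-\xi,-\eta)$ if necessary, one assumes $\varepsilon=1$. *)

(* Defs.v *)
From HB Require Import structures.
From mathcomp Require Import all_boot all_order all_algebra.
From mathcomp Require Import all_classical all_reals all_analysis.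
From mathcomp Require Import ring.
Set Implicit Arguments.
Unset Strict Implicit.
Unset Printing Implicit Defensive.
Import Order.TTheory GRing.Theory Num.Theory.
Import numFieldNormedType.Exports.
Local Open Scope classical_set_scope.
Local Open Scope ring_scope.

(* On an open set U of a finite-dimensional V: all iterated directional
   derivatives of order at most k exist and are continuous. *)
Fixpoint Ck (R : realType) (V W : normedModType R) (k : nat) (U : set V)
    (f : V -> W) : Prop :=
  (forall x, U x -> {for x, continuous f}) /\
  (if k is k'.+1 then
     forall v, (forall x, U x -> derivable f x v) /\
               Ck k' U (fun x => 'D_v f x)
   else True).

Definition smooth_on (R : realType) (V W : normedModType R) (U : set V)
  (f : V -> W) : Prop := forall k, Ck k U f.

Section Smooth_on_theory.
Variables (R : realType) (V : normedModType R).

Lemma Ck_eq (W : normedModType R) (U : set V) (oU : open U) k (f g : V -> W) :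
  (forall x, U x -> f x = g x) -> Ck k U f -> Ck k U g.
Proof.
have nearU (p q : V -> W) x : (forall y, U y -> p y = q y) -> U x ->
    \forall y \near x, p y = q y.
  by move=> pq Ux; exact: filterS pq (open_nbhs_nbhs (conj oU Ux)).
elim: k f g => [|k IH] f g fg /= [cf df]; split => //.
- move=> x Ux; rewrite /prop_for /continuous_at -(fg _ Ux).
  by apply: cvg_trans (cf _ Ux); apply: near_eq_cvg; exact: nearU fg Ux.
- move=> x Ux; rewrite /prop_for /continuous_at -(fg _ Ux).
  by apply: cvg_trans (cf _ Ux); apply: near_eq_cvg; exact: nearU fg Ux.
- move=> v; have [dfv Cf] := df v; split => [x Ux|].
    by apply: near_eq_derivable (dfv x Ux); exact: nearU fg Ux.
  apply: IH Cf => x Ux.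
  by apply: near_eq_derive; exact: nearU fg Ux.
Qed.

Lemma Ck_cst (W : normedModType R) (U : set V) k (c : W) :
  Ck k U (cst c : V -> W).
Proof.
elim: k c => [|k IH] c /=; split => //; try by move=> x _; exact: cst_continuous.
move=> v; split => [x _|]; first exact: derivable_cst.
rewrite (_ : (fun x => _) = cst 0) //.
by apply/funext => x; rewrite derive_cst.
Qed.

Lemma Ck_pred (W : normedModType R) (U : set V) k (f : V -> W) :
  Ck k.+1 U f -> Ck k U f.
Proof.
elim: k f => [|k IH] f [cf df]; split => // v.
by have [dfv Cf] := df v; split => //; exact: IH.
Qed.

Lemma CkB (W : normedModType R) (U : set V) (oU : open U) k (f g : V -> W) :
  Ck k U f -> Ck k U g -> Ck k U (f - g).
Proof.
elim: k f g => [|k IH] f g [cf df] [cg dg]; split => //.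
- by move=> x Ux; apply: cvgB; [exact: cf|exact: cg].
- by move=> x Ux; apply: cvgB; [exact: cf|exact: cg].
- move=> v; have [dfv Cf] := df v; have [dgv Cg] := dg v; split => [x Ux|].
    by apply: derivableB; [exact: dfv|exact: dgv].
  apply: Ck_eq (IH _ _ Cf Cg) => // x Ux.
  by rewrite deriveB //; [exact: dfv|exact: dgv].
Qed.

Lemma CkD (W : normedModType R) (U : set V) (oU : open U) k (f g : V -> W) :
  Ck k U f -> Ck k U g -> Ck k U (f + g).
Proof.
move=> Cf Cg; rewrite -[g]opprK -[- g]sub0r; apply: CkB => //.
by apply: CkB => //; exact: Ck_cst.
Qed.

Lemma CkM (U : set V) (oU : open U) k (f g : V -> R) :
  Ck k U f -> Ck k U g -> Ck k U (f * g).
Proof.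
elim: k f g => [|k IH] f g Hf Hg; have [cf df] := Hf; have [cg dg] := Hg;
  split => //.
- by move=> x Ux; apply: cvgM; [exact: cf|exact: cg].
- by move=> x Ux; apply: cvgM; [exact: cf|exact: cg].
- move=> v; have [dfv Cf] := df v; have [dgv Cg] := dg v; split => [x Ux|].
    by apply: derivableM; [exact: dfv|exact: dgv].
  apply: (@Ck_eq _ _ _ _ (f * (fun x => 'D_v g x) + g * (fun x => 'D_v f x))).
  + exact: oU.
  + by move=> x Ux; rewrite deriveM //; [exact: dfv|exact: dgv].
  + by apply: CkD => //; apply: IH => //; exact: Ck_pred.
Qed.

End Smooth_on_theory.

Record chart (R : realType) (M : topologicalType) (n : nat) := Chart {
  cdom : set M;
  cmap : M -> 'rV[R]_n;
  cinv : 'rV[R]_n -> M;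
  cdom_open : open cdom;
  cim_open : open (cmap @` cdom);
  cmapK : forall p, cdom p -> cinv (cmap p) = p;
  cmap_continuous : forall p, cdom p -> {for p, continuous cmap};
  cinv_continuous : forall x, (cmap @` cdom) x -> {for x, continuous cinv} }.

Record manifold (R : realType) (n : nat) := Manifold {
  points :> topologicalType;
  points_hausdorff : hausdorff_space points;
  points_second_countable : @second_countable points;
  atlas : set (chart R points n);
  atlas_cover : forall p : points, exists2 c, atlas c & cdom c p;
  atlas_compat : forall c d, atlas c -> atlas d ->
    smooth_on (cmap c @` (cdom c `&` cdom d)) (cmap d \o cinv c) }.

Definition smooth (R : realType) (n : nat) (M : manifold R n) (f : M -> R)
    : Prop :=
  forall c, atlas c -> smooth_on (cmap c @` cdom c) (f \o cinv c).

Definition smooth_pred (R : realType) (n : nat) (M : manifold R n) :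
  pred (M -> R) := fun f => `[< smooth f >].

Record smoothFun (R : realType) (n : nat) (M : manifold R n) := SmoothFun {
  sfun :> M -> R;
  sfunP : sfun \in @smooth_pred R n M }.

Section SmoothFun_ring.
Variables (R : realType) (n : nat) (M : manifold R n).

Lemma smooth_subring_closed : subring_closed (@smooth_pred R n M).
Proof.
split => [|f g /asboolP Hf /asboolP Hg|f g /asboolP Hf /asboolP Hg];
  apply/asboolP => c ac k.
- exact: Ck_cst.
- exact: (Ck_eq (@cim_open _ _ _ c) _ (CkB (@cim_open _ _ _ c) (Hf c ac k) (Hg c ac k))).
- exact: (Ck_eq (@cim_open _ _ _ c) _ (CkM (@cim_open _ _ _ c) (Hf c ac k) (Hg c ac k))).
Qed.

HB.instance Definition _ := GRing.isSubringClosed.Build (M -> R)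
  (@smooth_pred R n M) smooth_subring_closed.

HB.instance Definition _ := [isSub for @sfun R n M].
HB.instance Definition _ := [Choice of smoothFun M by <:].
HB.instance Definition _ := 
  GRing.SubChoice_isSubComPzRing.Build (M -> R) (@smooth_pred R n M)
    (smoothFun M) smooth_subring_closed.

Lemma smooth_cst (r : R) : (cst r : M -> R) \in @smooth_pred R n M.
Proof. by apply/asboolP => c _ k; exact: Ck_cst. Qed.

Definition scst (r : R) : smoothFun M := SmoothFun (smooth_cst r).

End SmoothFun_ring.

Notation "'C^oo' ( M )" := (smoothFun M) (at level 8, format "'C^oo' ( M )")
  : type_scope.

(* Vector fields are the R-linear derivations of the ring of smooth functions;
   they form a module over that ring. *)
Definition is_derivation (R : realType) (n : nat) (M : manifold R n)
    (X : C^oo(M) -> C^oo(M)^o) : Prop :=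
  [/\ forall f h, X (f + h) = X f + X h,
      forall (r : R) f, X (scst M r * f) = scst M r * X f
    & forall f h, X (f * h) = X f * h + f * X h].

Definition derivation_pred (R : realType) (n : nat) (M : manifold R n) :
  pred (C^oo(M) -> C^oo(M)^o) := fun X => `[< is_derivation X >].

Record vfield (R : realType) (n : nat) (M : manifold R n) := VField {
  vfun :> C^oo(M) -> C^oo(M)^o;
  vfunP : vfun \in @derivation_pred R n M }.

Section VField_module.
Variables (R : realType) (n : nat) (M : manifold R n).

Lemma derivation_submod_closed : submod_closed (@derivation_pred R n M).
Proof.
split => [|a X Y /asboolP[XD XZ XM] /asboolP[YD YZ YM]]; apply/asboolP.
  split=> [f h|r f|f h].
  - by rewrite [RHS]addr0.
  - by rewrite [RHS]mulr0.
  - by rewrite [X in X + _]mul0r [X in _ + X]mulr0 addr0.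
have E f : (a *: X + Y) f = (a : C^oo(M)) * X f + Y f by [].
split=> [f h|r f|f h]; rewrite !E.
- by rewrite XD YD mulrDr addrACA.
- by rewrite XZ YZ mulrDr mulrCA.
- by rewrite XM YM; ring.
Qed.

HB.instance Definition _ := GRing.isSubmodClosed.Build C^oo(M)
  (C^oo(M) -> C^oo(M)^o) (@derivation_pred R n M) derivation_submod_closed.

HB.instance Definition _ := [isSub for @vfun R n M].
HB.instance Definition _ := [Choice of vfield M by <:].
HB.instance Definition _ := [SubChoice_isSubLmodule of vfield M by <:].

Lemma lieb_subproof (X Y : vfield M) :
  (fun f => X (Y f) - Y (X f)) \in @derivation_pred R n M.
Proof.
have /asboolP[XD XZ XM] := vfunP X; have /asboolP[YD YZ YM] := vfunP Y.
apply/asboolP; split=> [f h|r f|f h].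
- by rewrite YD !XD YD opprD addrACA.
- by rewrite YZ !XZ YZ mulrBr.
- rewrite YM XM XD YD !XM !YM; ring.
Qed.

End VField_module.

Definition lieb (R : realType) (n : nat) (M : manifold R n) (X Y : vfield M) :
  vfield M := VField (lieb_subproof X Y).

Notation "'X^oo' ( M )" := (vfield M) (at level 8, format "'X^oo' ( M )")
  : type_scope.

(* The action of real constants on vector fields. *)
Notation "r *~: X" := (scst _ r *: X) (at level 40) : ring_scope.

(* X and Y have the same value in the tangent space at p. *)
Definition vf_eq_at (R : realType) (n : nat) (M : manifold R n) (p : M)
  (X Y : X^oo(M)) : Prop := forall f : C^oo(M), X f p = Y f p.

(* Every tangent vector is the value of a global vector field, so the second
   conjunct is nondegeneracy on each tangent space. *)
Definition pseudo_riemannian (R : realType) (n : nat) (M : manifold R n)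
    (g : X^oo(M) -> X^oo(M) -> C^oo(M)) : Prop :=
  [/\ forall X Y, g X Y = g Y X,
      forall (f : C^oo(M)) X Y Z, g (f *: X + Y) Z = f * g X Z + g Y Z
    & forall p X, (forall Y, g X Y p = 0) -> vf_eq_at p X 0].

Record apcm (R : realType) (n : nat) (M : manifold R n) :=
  AlmostParaContactMetric {
  phi : {linear X^oo(M) -> X^oo(M)};
  xi : X^oo(M);
  eta : {linear X^oo(M) -> C^oo(M)^o};
  metric : X^oo(M) -> X^oo(M) -> C^oo(M);
  metricP : pseudo_riemannian metric;
  phi_phi : forall X, phi (phi X) = X - eta X *: xi;
  eta_xi : eta xi = 1;
  metric_phi : forall X Y,
    metric (phi X) (phi Y) = - metric X Y + eta X * eta Y;
  etaE : forall X, eta X = metric xi X }.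

Section Geometry.
Variables (R : realType) (n : nat) (M : manifold R n).
Implicit Types (s : apcm M) (X Y Z : X^oo(M)) (f : C^oo(M)).
Implicit Types (nabla : X^oo(M) -> X^oo(M) -> X^oo(M)).

Definition levi_civita (g : X^oo(M) -> X^oo(M) -> C^oo(M)) nabla : Prop :=
  [/\ forall f X X' Y, nabla (f *: X + X') Y = f *: nabla X Y + nabla X' Y,
      forall X Y Y', nabla X (Y + Y') = nabla X Y + nabla X Y',
      forall f X Y, nabla X (f *: Y) = X f *: Y + f *: nabla X Y,
      forall X Y, nabla X Y - nabla Y X = lieb X Y
    & forall X Y Z, X (g Y Z) = g (nabla X Y) Z + g Y (nabla X Z)].

Definition curvature nabla X Y Z : X^oo(M) :=
  nabla X (nabla Y Z) - nabla Y (nabla X Z) - nabla (lieb X Y) Z.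

Definition closed1 (a : X^oo(M) -> C^oo(M)) : Prop :=
  forall X Y, X (a Y) - Y (a X) - a (lieb X Y) = 0.

Definition closed2 (w : X^oo(M) -> X^oo(M) -> C^oo(M)) : Prop :=
  forall X Y Z,
    X (w Y Z) + Y (w Z X) + Z (w X Y)
    - w (lieb X Y) Z - w (lieb Y Z) X - w (lieb Z X) Y = 0.

Definition fundamental_form s X Y : C^oo(M) := metric s (phi s X) Y.

Definition almost_para_cosymplectic s : Prop :=
  closed1 (eta s) /\ closed2 (fundamental_form s).

Definition weakly_para_cosymplectic s nabla : Prop :=
  almost_para_cosymplectic s /\
  forall X Y Z,
    curvature nabla X Y (phi s Z) = phi s (curvature nabla X Y Z).

(* The leaves of the foliation eta = 0 are handled through the module of
   vector fields tangent to them: [D] below is, leaf by leaf, the Levi-Civita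
   connection of the restriction of the metric to the leaf. *)
Definition leaf_tangent s X : Prop := eta s X = 0.

Definition leaf_levi_civita s (D : X^oo(M) -> X^oo(M) -> X^oo(M)) : Prop :=
  (forall X Y, leaf_tangent s X -> leaf_tangent s Y ->
     leaf_tangent s (D X Y)) /\
  [/\ forall f X X' Y, leaf_tangent s X -> leaf_tangent s X' ->
        leaf_tangent s Y -> D (f *: X + X') Y = f *: D X Y + D X' Y,
      forall X Y Y', leaf_tangent s X -> leaf_tangent s Y ->
        leaf_tangent s Y' -> D X (Y + Y') = D X Y + D X Y',
      forall f X Y, leaf_tangent s X -> leaf_tangent s Y ->
        D X (f *: Y) = X f *: Y + f *: D X Y,
      forall X Y, leaf_tangent s X -> leaf_tangent s Y ->
        D X Y - D Y X = lieb X Y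
    & forall X Y Z, leaf_tangent s X -> leaf_tangent s Y ->
        leaf_tangent s Z ->
        X (metric s Y Z) = metric s (D X Y) Z + metric s Y (D X Z)].

Definition para_kahler_leaves s : Prop :=
  exists2 D, leaf_levi_civita s D &
    forall X Y, leaf_tangent s X -> leaf_tangent s Y ->
      D X (phi s Y) = phi s (D X Y).

Definition shape s nabla X : X^oo(M) := - nabla X (xi s).

(* Local vector fields near a point extend to global ones after shrinking the
   neighborhood, so V1 and V2 may be taken global and constrained on U only. *)
Definition shape_normal_form (sigma : R) s nabla : Prop :=
  forall p : M, exists (U : set M) (V1 V2 : X^oo(M)) (eps : R),
    [/\ open_nbhs p U, eps = 1 \/ eps = -1 &
        forall q : M, U q ->
          [/\ ~ vf_eq_at q V1 0 /\ ~ vf_eq_at q V2 0,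
              vf_eq_at q (phi s V1) (- V1),
              vf_eq_at q (phi s V2) V2,
              metric s V1 V2 q = 0 &
              forall X, vf_eq_at q (shape s nabla X)
                (eps *~: (metric s X V1 *: V1
                          + sigma *~: (metric s X V2 *: V2)))]].

Definition elliptic s nabla : Prop := shape_normal_form 1 s nabla.
Definition hyperbolic s nabla : Prop := shape_normal_form (-1) s nabla.

End Geometry.

Record lieGroup (R : realType) (n : nat) := LieGroup {
  lg_manifold :> manifold R n;
  lg_mul : lg_manifold -> lg_manifold -> lg_manifold;
  lg_one : lg_manifold;
  lg_inv : lg_manifold -> lg_manifold;
  lg_mulA : associative lg_mul;
  lg_mul1 : left_id lg_one lg_mul;
  lg_mulV : left_inverse lg_one lg_inv lg_mul;
  lg_mul_continuous :
    continuous (fun p : lg_manifold * lg_manifold => lg_mul p.1 p.2);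
  lg_mul_smooth : forall c d e : chart R lg_manifold n,
    atlas c -> atlas d -> atlas e ->
    smooth_on
      [set z : 'rV[R]_n * 'rV[R]_n |
        [/\ (cmap c @` cdom c) z.1, (cmap d @` cdom d) z.2 &
            cdom e (lg_mul (cinv c z.1) (cinv d z.2))]]
      (fun z => cmap e (lg_mul (cinv c z.1) (cinv d z.2)));
  lg_inv_continuous : continuous lg_inv;
  lg_inv_smooth : forall c e : chart R lg_manifold n, atlas c -> atlas e ->
    smooth_on
      [set x : 'rV[R]_n |
        (cmap c @` cdom c) x /\ cdom e (lg_inv (cinv c x))]
      (fun x => cmap e (lg_inv (cinv c x))) }.

Section LieGroup_theory.
Variables (R : realType) (n : nat) (G : lieGroup R n).

(* Y is the image of X under the left translation by a. *)
Definition translate (a : G) (X Y : X^oo(G)) : Prop :=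
  forall f h : C^oo(G), (forall p, h p = f (lg_mul a p)) ->
    forall p, X h p = Y f (lg_mul a p).

Definition left_invariant (X : X^oo(G)) : Prop :=
  forall a, translate a X X.

Definition left_invariant_structure (s : apcm G) : Prop :=
  [/\ forall a X X', translate a X X' -> translate a (phi s X) (phi s X'),
      left_invariant (xi s),
      forall a X X', translate a X X' ->
        forall p, eta s X p = eta s X' (lg_mul a p)
    & forall a X X' Y Y', translate a X X' -> translate a Y Y' ->
        forall p, metric s X Y p = metric s X' Y' (lg_mul a p)].

(* The Lie algebra of G is the real vector space of left-invariant fields. *)
Definition lie_algebra_basis (k : nat) (b : k.-tuple X^oo(G)) : Prop :=
  (forall i, left_invariant (tnth b i)) /\
  forall X, left_invariant X ->
    exists! c : 'rV[R]_k, X = \sum_(i < k) c ord0 i *~: tnth b i.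

End LieGroup_theory.

Section Classes.
Variables (R : realType) (G : lieGroup R 5).

(* The ten brackets of the basis (x, v1, v2, v3, v4), in the order
   x1 x2 x3 x4 12 13 14 23 24 34. *)
Definition bracket_table (x v1 v2 v3 v4 : X^oo(G))
    (bx1 bx2 bx3 bx4 b12 b13 b14 b23 b24 b34 : X^oo(G)) : Prop :=
  lie_algebra_basis [tuple x; v1; v2; v3; v4] /\
  [/\ lieb x v1 = bx1, lieb x v2 = bx2, lieb x v3 = bx3 & lieb x v4 = bx4] /\
  [/\ lieb v1 v2 = b12, lieb v1 v3 = b13 & lieb v1 v4 = b14] /\
  [/\ lieb v2 v3 = b23, lieb v2 v4 = b24 & lieb v3 v4 = b34].

Definition class1 : Prop :=
  exists (x v1 v2 v3 v4 : X^oo(G)) (sigma a1 a2 b1 b2 : R),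
    [/\ sigma = 1 \/ sigma = -1, a1 != 0, a2 != 0 &
      bracket_table x v1 v2 v3 v4
        (* x1 *) 0
        (* x2 *) 0
        (* x3 *) (v1 + (sigma * (a1 / a2)) *~: v2)
        (* x4 *) ((- (sigma * (a1 / a2))) *~: v1 + sigma *~: v2)
        (* 12 *) 0
        (* 13 *) ((- a1) *~: v1)
        (* 14 *) 0
        (* 23 *) ((- a1) *~: v2)
        (* 24 *) (a1 *~: v1 - a2 *~: v2)
        (* 34 *) ((- b1) *~: v1 - b2 *~: v2)].

Definition class2 : Prop :=
  exists (x v1 v2 v3 v4 : X^oo(G)) (sigma a1 a2 b1 b2 : R),
    [/\ sigma = 1 \/ sigma = -1, a1 != 0, a2 != 0 &
      bracket_table x v1 v2 v3 v4
        (* x1 *) 0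
        (* x2 *) 0
        (* x3 *) (v1 - (a2 / a1) *~: v2)
        (* x4 *) ((a2 / a1) *~: v1 + sigma *~: v2)
        (* 12 *) 0
        (* 13 *) ((- a1) *~: v1 + a2 *~: v2)
        (* 14 *) ((- a2) *~: v1)
        (* 23 *) 0
        (* 24 *) ((- a2) *~: v2)
        (* 34 *) ((- b1) *~: v1 - b2 *~: v2)].

Definition class3 : Prop :=
  exists (x v1 v2 v3 v4 : X^oo(G)) (sigma a1 a2 b1 b2 : R),
    (sigma = 1 \/ sigma = -1) /\
      bracket_table x v1 v2 v3 v4
        (* x1 *) 0
        (* x2 *) 0
        (* x3 *) v1
        (* x4 *) (sigma *~: v2)
        (* 12 *) 0
        (* 13 *) ((- a1) *~: v1)
        (* 14 *) 0
        (* 23 *) 0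
        (* 24 *) ((- a2) *~: v2)
        (* 34 *) ((- b1) *~: v1 - b2 *~: v2).

Definition class4 : Prop :=
  exists (x v1 v2 v3 v4 : X^oo(G)) (sigma a0 b1 b2 : R),
    [/\ sigma = 1 \/ sigma = -1, a0 != 0 &
      bracket_table x v1 v2 v3 v4
        (* x1 *) 0
        (* x2 *) 0
        (* x3 *) (v1 + a0 *~: v2)
        (* x4 *) ((- a0) *~: v1 + sigma *~: v2)
        (* 12 *) 0
        (* 13 *) 0
        (* 14 *) 0
        (* 23 *) 0
        (* 24 *) 0
        (* 34 *) ((- b1) *~: v1 - b2 *~: v2)].

End Classes.

(* Main.v *)
(* On left-invariant fields all the structure tensors are constant, so the
   theorem reduces to linear algebra over R once the left-invariant fields are
   known to form a 5-dimensional space. Hadamard's lemma together with bump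
   functions shows that a derivation at a point is a combination of the 5
   partial derivatives of a chart, and smoothness of the multiplication extends
   each partial derivative at the identity to a left-invariant field.

   Let V_3, V_4 be eigenvectors of phi dual to V_1, V_2. The leaf condition says
   that nabla_X preserves the two eigenbundles of phi inside the leaves, dPhi = 0
   extends this to X = xi, and R(X, Y) xi = 0 (a consequence of R phi = phi R) is
   a Codazzi equation for A = V_1 (x) V_1 + sigma V_2 (x) V_2. Together they leave
   only nabla V_1 = a V_1^* (x) V_1, nabla V_2 = b V_2^* (x) V_2 and the form
   m(X) = g(nabla_X V_3, V_4) undetermined. With m_0 = m(xi), m_1 = m(V_1) and
   m_2 = m(V_2), the Jacobi identities for (V_1, V_3, V_4), (V_2, V_3, V_4) and
   (xi, V_3, V_4) read
     m_1 m_2 = m_1 (m_1 - b) = m_2 (m_2 + a) = 0,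
     m_1 + m_0 m_2 + m_0 a = m_0 m_1 - m_0 b - sigma m_2 = 0.
   The cases m_2 <> 0; m_1 <> 0; m_0 = m_1 = m_2 = 0; only m_0 <> 0 are the
   classes 1, 2, 3, 4. *)
Require Import Defs.
From HB Require Import structures.
From mathcomp Require Import all_boot all_order all_algebra.
From mathcomp Require Import all_classical all_reals all_analysis.
From mathcomp Require Import ring lra.
Set Implicit Arguments.
Unset Strict Implicit.
Unset Printing Implicit Defensive.
Import Order.TTheory GRing.Theory Num.Theory.
Import numFieldNormedType.Exports.
Local Open Scope classical_set_scope.
Local Open Scope ring_scope.

(** * Calculus of C^k functions *)

Section Lines.
Variables (R : realType) (V : normedModType R).
Implicit Types (f : V -> R) (b v w : V).

Lemma is_derive_line (W : normedModType R) (f : V -> W) b w (t : R) : derivable f (b + t *: w) w ->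
  is_derive t 1 (fun s : R => f (b + s *: w)) ('D_w f (b + t *: w)).
Proof.
move=> df.
have E : (fun h : R => h^-1 *: (((fun s : R => f (b + s *: w)) \o shift t) (h *: 1)
      - f (b + t *: w))) =
    (fun h : R => h^-1 *: ((f \o shift (b + t *: w)) (h *: w) - f (b + t *: w))).
  apply/funext => h /=; congr (_ *: (f _ - _)).
  by rewrite scalerDl [h *: 1]mulr1 addrCA.
by split; [rewrite /derivable E | rewrite /derive E].
Qed.

Lemma line_growth_rate (W : normedModType R) (f : V -> W) b w :
  (fun h : R => h^-1 *: (((fun s : R => f (b + s *: w)) \o shift 0) (h *: 1)
      - f (b + 0 *: w))) =
  (fun h : R => h^-1 *: ((f \o shift b) (h *: w) - f b)).
Proof.
apply/funext => h /=; congr (_ *: (f _ - f _)); last by rewrite scale0r addr0.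
by rewrite addr0 [h *: 1]mulr1 addrC.
Qed.

Lemma derivable_line0 (W : normedModType R) (f : V -> W) b w :
  derivable (fun s : R => f (b + s *: w)) 0 1 = derivable f b w.
Proof. by rewrite /derivable line_growth_rate. Qed.

Lemma derive_line0 (W : normedModType R) (f : V -> W) b w :
  'D_1 (fun s : R => f (b + s *: w)) 0 = 'D_w f b.
Proof. by rewrite /derive line_growth_rate. Qed.

Lemma differentiable_line0 (W : normedModType R) (f : V -> W) b w :
  derivable f b w -> differentiable (fun s : R => f (b + s *: w)) 0.
Proof. by rewrite -derivable_line0 => /derivable1_diffP. Qed.

Lemma MVT_line f b w :
  (forall t : R, 0 <= t <= 1 -> derivable f (b + t *: w) w) ->
  exists2 t : R, 0 <= t <= 1 & f (b + w) - f b = 'D_w f (b + t *: w).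
Proof.
move=> df.
have [|||c cI] := @MVT_segment R (fun s : R => f (b + s *: w))
    (fun s => 'D_w f (b + s *: w)) 0 1.
- exact: ler01.
- move=> x; rewrite in_itv/= => /andP[x0 x1]; apply: is_derive_line.
  by apply: df; rewrite !ltW.
- apply: derivable_within_continuous => x; rewrite in_itv/= => xI.
  by have := is_derive_line (df x xI); case.
rewrite scale1r scale0r addr0 subr0 mulr1 => E.
by exists c => //; move: cI; rewrite in_itv.
Qed.

Lemma is_derive_dirZ f b v (c : R) : derivable f b v ->
  is_derive b (c *: v) f (c * 'D_v f b).
Proof.
move=> df.
have [->|c0] := eqVneq c 0.
  by rewrite scale0r mul0r; apply: is_derive0.
have dl : is_derive (0 : R) 1 (fun s : R => f (b + s *: v)) ('D_v f b).
  by split; rewrite ?derivable_line0 ?derive_line0.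
have dl' : is_derive (0 : R) 1 ((fun s : R => f (b + s *: v)) \o (fun s : R => c * s))
   (c * 'D_v f b).
  have d1 : is_derive (0 : R) 1 (fun s : R => c * s) c.
    have /= := @is_deriveZ R R R id c 0 1 1 (is_derive_id _ _).
    by rewrite [c *: 1]mulr1.
  have d2 : is_derive (c * 0 : R) 1 (fun s : R => f (b + s *: v)) ('D_v f b) by rewrite mulr0.
  have := is_derive1_comp d2 d1.
  by rewrite mulrC.
have E : (fun h : R => h^-1 *: (((fun s : R => f (b + s *: v)) \o (fun s : R => c * s)) 
      (h *: 1 + 0) - f (b + (c * 0) *: v))) =
    (fun h : R => h^-1 *: ((f \o shift b) (h *: (c *: v)) - f b)).
  apply/funext => h /=; rewrite mulr0 scale0r !addr0; congr (_ *: (f _ - _)).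
  by rewrite [h *: 1]mulr1 scalerA mulrC addrC.
case: dl' => D1 D2; split.
  by move: D1; rewrite /derivable E.
by move: D2; rewrite /derive E.
Qed.

End Lines.

Lemma near_forall_fin (T : topologicalType) (I : finType) (x : T)
    (P : I -> T -> Prop) :
  (forall i, \forall y \near x, P i y) -> \forall y \near x, forall i, P i y.
Proof. exact: filter_forall. Qed.

Lemma continuous_sum_at (R : realType) (T : topologicalType)
    (V : normedModType R) (I : Type) (r : seq I) (P : pred I) (f : I -> T -> V) x :
  (forall i, {for x, continuous (f i)}) ->
  {for x, continuous (fun z => \sum_(i <- r | P i) f i z)}.
Proof.
move=> cf; elim: r => [|i r IH].
  rewrite (_ : (fun z => _) = cst 0); first exact: cst_continuous.
  by apply/funext => z; rewrite big_nil.
rewrite (_ : (fun z => _) =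
    fun z => (if P i then f i z else 0) + \sum_(j <- r | P j) f j z).
  apply: cvgD; last exact: IH.
  by case: (P i); [exact: cf | exact: cst_continuous].
by apply/funext => z; rewrite big_cons; case: (P i); rewrite ?add0r.
Qed.

Section C1_differentiable.
Variables (R : realType) (n : nat).
Implicit Types (a h : 'rV[R]_n) (f : 'rV[R]_n -> R).

Local Notation e_ j := (delta_mx 0 j : 'rV[R]_n).

Definition row_trunc h k : 'rV[R]_n := \row_j (if (j < k)%N then h 0 j else 0).

Lemma row_trunc0 h : row_trunc h 0 = 0.
Proof. by apply/rowP => j; rewrite !mxE. Qed.

Lemma row_truncn h : row_trunc h n = h.
Proof. by apply/rowP => j; rewrite !mxE ltn_ord. Qed.

Lemma row_truncS h (j : 'I_n) : row_trunc h j.+1 = row_trunc h j + h 0 j *: e_ j.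
Proof.
apply/rowP => i; rewrite !mxE /= ltnS leq_eqVlt.
have -> : (nat_of_ord i == j) = (i == j) by [].
by case: (i =P j) => [->|_] /=; rewrite ?ltnn ?mulr1 ?add0r ?mulr0 ?addr0.
Qed.

Lemma coord_le_norm h j : `|h 0 j| <= `|h|.
Proof.
rewrite [leRHS]/Num.Def.normr/= mx_normrE.
exact: (le_bigmax _ (fun i : 'I_1 * 'I_n => `|h i.1 i.2|) (0, j)).
Qed.

Lemma norm_le_coord h (r : R) : 0 <= r -> (forall j, `|h 0 j| <= r) -> `|h| <= r.
Proof.
move=> r0 hr; rewrite [leLHS]/Num.Def.normr/= mx_normrE.
by apply: bigmax_le => // -[i j] _ /=; rewrite ord1.
Qed.

Lemma norm_lt_coord h (r : R) : 0 < r -> (forall j, `|h 0 j| < r) -> `|h| < r.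
Proof.
move=> r0 hr; rewrite [ltLHS]/Num.Def.normr/= mx_normrE.
by apply: bigmax_lt => // -[i j] _ /=; rewrite ord1.
Qed.

Lemma C1_differentiable (U : set 'rV[R]_n) f a :
  open U -> U a -> Ck 1 U f -> differentiable f a.
Proof.
move=> oU Ua [_ df].
pose d h := \sum_j h 0 j * 'D_(e_ j) f a.
have lind : linear d.
  move=> c u v; rewrite /d scaler_sumr -big_split /=; apply: eq_bigr => j _.
  by rewrite !mxE mulrDl -mulrA.
pose dM := GRing.isLinear.Build _ _ _ _ _ lind.
pose dL : {linear _ -> _} := HB.pack d dM.
have cd : continuous (dL : _ -> _).
  move=> x; apply: continuous_sum_at => j.
  have cj : (fun h => h 0 j) @ x --> x 0 j by exact: coord_continuous.
  exact: cvgMr_tmp cj.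
suff o : f \o shift a = (cst (f a) + (dL : 'rV[R]_n -> R)) +o_ (0 : 'rV[R]_n) id.
  by apply/diff_locallyP; rewrite (diff_unique cd o).
apply/eqaddoP => _/posnumP[eps] /=.
have e0 : 0 < eps%:num / (n.+1%:R : R) by rewrite divr_gt0.
have nU : \forall x \near a, U x by exact: open_nbhs_nbhs.
have nD : \forall x \near a, forall j,
    `|'D_(e_ j) f a - 'D_(e_ j) f x| <= eps%:num / n.+1%:R.
  apply: near_forall_fin => j; have [_ [cD _]] := df (e_ j).
  by have /cvgrPdist_le/(_ _ e0) := cD a Ua.
have /nbhs_ballP[r /= r0 rP] : nbhs a (fun x => U x /\ forall j,
    `|'D_(e_ j) f a - 'D_(e_ j) f x| <= eps%:num / n.+1%:R).
  exact: filterI nU nD.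
have nr : \forall h \near (0 : 'rV[R]_n), `|h| < r by exact: nbhs0_lt.
near=> h.
have hr : `|h| < r by near: h; exact: nr.
have seg k (t : R) : 0 <= t <= 1 -> forall j : 'I_n, nat_of_ord j = k ->
    ball a r (a + (row_trunc h k + t *: (h 0 j *: e_ j))).
  move=> /andP[t0 t1] j jk; rewrite -ball_normE /ball_/= opprD addNKr normrN.
  apply: le_lt_trans hr; apply: norm_le_coord => // i; rewrite !mxE /=.
  case: (i =P j) => [->|_]; last first.
    by rewrite !mulr0 addr0; case: ifP => _; rewrite ?normr0 ?coord_le_norm.
  rewrite jk ltnn add0r mulr1 normrM ger0_norm //.
  by apply: le_trans (coord_le_norm h j); rewrite ler_piMl.
have step (j : 'I_n) : `|f (a + row_trunc h j.+1) - f (a + row_trunc h j)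
     - h 0 j * 'D_(e_ j) f a| <= eps%:num / n.+1%:R * `|h|.
  have [|t tI] := @MVT_line R _ f (a + row_trunc h j) (h 0 j *: e_ j).
    move=> t tI; rewrite -addrA; have [Ux _] := rP _ (seg j t tI j erefl).
    by have [+ _] := df (h 0 j *: e_ j); apply.
  rewrite -addrA -row_truncS => ->; rewrite -addrA.
  have [Ux Dx] := rP _ (seg j t tI j erefl).
  have [dj _] := df (e_ j).
  have [_ ->] := is_derive_dirZ (h 0 j) (dj _ Ux).
  rewrite -mulrBr normrM mulrC ler_pM ?coord_le_norm //.
  by rewrite distrC; exact: Dx.
have -> : (f \o shift a - (cst (f a) + d)) h = 
   \sum_(j < n) (f (a + row_trunc h j.+1) - f (a + row_trunc h j) - h 0 j * 'D_(e_ j) f a).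
  rewrite sumrB -(big_mkord predT (fun j => f (a + row_trunc h j.+1) - f (a + row_trunc h j))).
  rewrite (telescope_sumr (fun j => f (a + row_trunc h j))) // row_truncn row_trunc0 addr0.
  by rewrite opprD addrA [a + h]addrC.
apply: le_trans (ler_norm_sum _ _ _) _.
apply: (@le_trans _ _ (\sum_(j < n) eps%:num / n.+1%:R * `|h|)).
  by apply: ler_sum.
rewrite sumr_const card_ord -mulrnAl ler_wpM2r // -mulr_natr -mulrA ler_piMr //.
by rewrite mulrC ler_pdivrMr ?mul1r ?ler_nat.
Unshelve. all: by end_near. Qed.

End C1_differentiable.

Section Ck_calculus.
Variables (R : realType) (V : normedModType R).

Lemma Ck_sub (W : normedModType R) (U U' : set V) k (f : V -> W) :
  U' `<=` U -> Ck k U f -> Ck k U' f.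
Proof.
move=> sub; elim: k f => [|k IH] f /= [cf df]; split => //; try by move=> x /sub/cf.
by move=> v; have [dv Cv] := df v; split; [move=> x /sub/dv | exact: IH].
Qed.

Lemma Ck_local (W : normedModType R) (U : set V) k (f : V -> W) :
  (forall x, U x -> exists2 N, N x & Ck k N f) -> Ck k U f.
Proof.
elim: k f => [|k IH] f loc /=; split => //.
- by move=> x /loc[N Nx [cf _]]; exact: cf.
- by move=> x /loc[N Nx [cf _]]; exact: cf.
- move=> v; split=> [x /loc[N Nx [_ df]]|]; first by have [dv _] := df v; exact: dv.
  by apply: IH => x /loc[N Nx [_ df]]; exists N => //; have [] := df v.
Qed.

Lemma Ck_continuous (W : normedModType R) (U : set V) k (f : V -> W) x :
  Ck k U f -> U x -> {for x, continuous f}.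
Proof. by case: k => [|k] [cf _] /cf. Qed.

Lemma Ck_leq (W : normedModType R) (U : set V) k l (f : V -> W) :
  (k <= l)%N -> Ck l U f -> Ck k U f.
Proof.
move=> kl; rewrite -(subnK kl); elim: (l - k)%N => // m IH.
by rewrite addSn => /Ck_pred/IH.
Qed.

Lemma Ck_coord (U : set V) n k (g : V -> 'rV[R]_n) j : open U ->
  Ck k U g -> Ck k U (fun z => g z 0 j).
Proof.
move=> oU; elim: k g => [|k IH] g Cg.
  split=> // x Ux; apply: (@continuous_comp _ _ _ g (fun M => M 0 j)).
    exact: Ck_continuous Cg Ux.
  exact: coord_continuous.
split.
  move=> x Ux; apply: (@continuous_comp _ _ _ g (fun M => M 0 j)).
    exact: Ck_continuous Cg Ux.
  exact: coord_continuous.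
move=> v; have [_ dg] := Cg; have [dv Cv] := dg v; split.
  by move=> x Ux; have /derivable_mxP := dv x Ux; apply.
apply: (Ck_eq oU) (IH _ Cv) => x Ux.
by rewrite derive_mx ?mxE//; exact: dv.
Qed.

Lemma Ck_sum (U : set V) k (I : Type) (r : seq I) (f : I -> V -> R) : open U ->
  (forall i, Ck k U (f i)) -> Ck k U (fun z => \sum_(i <- r) f i z).
Proof.
move=> oU Cf; elim: r => [|i r IH].
  by apply: (Ck_eq oU) (Ck_cst U k 0) => x _; rewrite big_nil.
by apply: (Ck_eq oU) (CkD oU (Cf i) IH) => x _; rewrite big_cons.
Qed.

End Ck_calculus.

Section Ck_composition.
Variables (R : realType) (V : normedModType R).

Lemma is_derive_comp_rV n (f : 'rV[R]_n -> R) (g : V -> 'rV[R]_n) x v :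
  differentiable f (g x) -> derivable g x v ->
  is_derive x v (f \o g)
    (\sum_j 'D_(delta_mx 0 j) f (g x) * 'D_v (fun z => g z 0 j) x).
Proof.
move=> df dg.
pose c s : 'rV[R]_n := g (x + s *: v).
have dc : differentiable c 0 by exact: differentiable_line0.
have c0 : c 0 = g x by rewrite /c scale0r addr0.
have df0 : differentiable f (c 0) by rewrite c0.
have dfc : differentiable (f \o c) 0 by exact: differentiable_comp.
have vE : 'D_v (f \o g) x = 'd f (g x) ('D_v g x).
  rewrite -(derive_line0 (f \o g)) -(derive_line0 g) -/(f \o c) -/c.
  by rewrite deriveE // diff_comp //= c0 [in RHS]deriveE.
split; first by rewrite -derivable_line0; exact: diff_derivable.
rewrite vE [X in 'd f _ X]row_sum_delta linear_sum; apply: eq_bigr => j _.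
rewrite linearZ -deriveE // mulrC; congr (_ * _).
by rewrite derive_mx // mxE.
Qed.

Lemma Ck_comp n (U : set V) (U' : set 'rV[R]_n) k (f : 'rV[R]_n -> R)
    (g : V -> 'rV[R]_n) : open U -> open U' -> (forall x, U x -> U' (g x)) ->
  Ck k U' f -> Ck k U g -> Ck k U (f \o g).
Proof.
move=> oU oU' gU; elim: k f => [|k IH] f Cf Cg.
  split => // x Ux; apply: continuous_comp; first exact: Ck_continuous Cg Ux.
  exact: (Ck_continuous Cf (gU _ Ux)).
have cfg x : U x -> {for x, continuous (f \o g)}.
  move=> Ux; apply: continuous_comp; first exact: Ck_continuous Cg Ux.
  exact: (Ck_continuous Cf (gU _ Ux)).
split => // v.
have [_ dg] := Cg; have [dv Cv] := dg v.
have dfg x : U x -> is_derive x v (f \o g)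
    (\sum_j 'D_(delta_mx 0 j) f (g x) * 'D_v (fun z => g z 0 j) x).
  move=> Ux; apply: is_derive_comp_rV; last exact: dv.
  by apply: (C1_differentiable oU' (gU _ Ux)); exact: Ck_leq Cf.
split; first by move=> x /dfg[].
apply: (Ck_eq oU (f := fun x =>
    \sum_j 'D_(delta_mx 0 j) f (g x) * 'D_v (fun z => g z 0 j) x)).
  by move=> x /dfg[].
apply: (Ck_sum _ (f := fun j x =>
    'D_(delta_mx 0 j) f (g x) * 'D_v (fun z => g z 0 j) x) oU) => j; apply: (CkM oU (f := fun x => 'D_(delta_mx 0 j) f (g x))).
  apply: (IH (fun y => 'D_(delta_mx 0 j) f y)); last exact: Ck_pred.
  by have [_ df] := Cf; have [] := df (delta_mx 0 j).
have [_ dgj] := Ck_coord j oU Cg.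
by have [] := dgj v.
Qed.

Lemma Ck_affine (V' : normedModType R) (U : set V') k (i : V -> V') (l : V -> V')
    (F : V' -> R) :
  continuous i -> (forall (h : R) v y, i (h *: v + y) = h *: l v + i y) ->
  Ck k U F -> Ck k (i @^-1` U) (F \o i).
Proof.
move=> ci il; elim: k F => [|k IH] F CF.
  by split => // x Ux; apply: continuous_comp; [exact: ci | exact: Ck_continuous CF Ux].
split; first by move=> x Ux; apply: continuous_comp; [exact: ci | exact: Ck_continuous CF Ux].
move=> v; have [_ dF] := CF; have [dv Cv] := dF (l v).
have E x : (fun h : R => h^-1 *: ((F \o i \o shift x) (h *: v) - (F \o i) x)) =
    (fun h : R => h^-1 *: ((F \o shift (i x)) (h *: l v) - F (i x))).
  by apply/funext => h /=; rewrite il.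
split=> [x Ux|]; first by rewrite /derivable E; exact: dv.
rewrite (_ : (fun x => _) = (fun x => 'D_(l v) F x) \o i); first exact: IH.
by apply/funext => x; rewrite /derive E.
Qed.

End Ck_composition.

(** * Bump functions and Hadamard's lemma *)

Section Bump.
Variable R : realType.

Lemma scaleRE (a b : R) : a *: b = a * b. Proof. by []. Qed.

Lemma poly_le_expR (p : {poly R}) k :
  exists2 C : R, 0 <= C & forall u : R, 1 <= u -> `|p.[u]| * u ^+ k <= C * expR u.
Proof.
have powE m : exists2 C : R, 0 <= C & forall u : R, 1 <= u -> u ^+ m <= C * expR u.
  exists (m.+1)`!%:R => // u u1.
  have u0 : 0 <= u by exact: le_trans u1.
  have H : u ^+ m.+1 / (m.+1)`!%:R <= expR u by have := expR_ge1Dxn m u0; lra.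
  apply: (@le_trans _ _ (u ^+ m.+1)); first by rewrite exprS ler_peMl ?exprn_ge0.
  have f0 : 0 < (m.+1)`!%:R :> R by rewrite ltr0n fact_gt0.
  by rewrite mulrC -ler_pdivrMr.
elim/poly_ind: p k => [|p c IH] k.
  by exists 0 => // u _; rewrite horner0 normr0 !mul0r.
have [C C0 HC] := IH k.+1; have [D D0 HD] := powE k.
exists (C + `|c| * D); first by rewrite addr_ge0 ?mulr_ge0.
move=> u u1; have u0 : 0 <= u by exact: le_trans u1.
rewrite hornerMXaddC.
apply: (@le_trans _ _ ((`|p.[u]| * u + `|c|) * u ^+ k)).
  rewrite ler_wpM2r ?exprn_ge0 //; apply: le_trans (ler_normD _ _) _.
  by rewrite normrM (ger0_norm u0).
rewrite !mulrDl -mulrA -exprS lerD ?HC // -mulrA ler_wpM2l //.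
exact: HD.
Qed.

(* Functions of this form, p(1/x) exp(-1/x) for x > 0, are closed under
   differentiation, hence smooth. *)
Definition flat (p : {poly R}) (x : R) : R :=
  if 0 < x then p.[x^-1] * expR (- x^-1) else 0.

Lemma is_derive_flat p (x : R) : is_derive x (1 : R) (flat p) (flat ('X^2 * (p - p^`())) x).
Proof.
have [x0|x0|->] := ltgtP x 0.
- rewrite /flat ltNge (ltW x0) /=.
  apply: (@near_eq_is_derive _ _ _ (cst 0)).
  near=> y; have y0 : y < 0 by near: y; exact: lt_nbhsl.
  by rewrite ltNge (ltW y0).
- rewrite [X in is_derive _ _ _ X]/flat x0.
  have dV : is_derive x 1 (fun y : R => y^-1) (- x ^- 2).
    have x0' : x != 0 by rewrite gt_eqF.
    split; first exact: (derivableV (f := id)).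
    by rewrite (deriveV (f := id)) // derive_id [_ *: 1]mulr1.
  have d1 : is_derive x 1 (fun y : R => p.[y^-1]) (p^`().[x^-1] * (- x ^- 2)).
    exact: (is_derive1_comp (is_derive_poly p _) dV).
  have d2 : is_derive x 1 (fun y : R => expR (- y^-1)) (expR (- x^-1) * (x ^- 2)).
    have dN : is_derive x 1 (fun y : R => - y^-1) (x ^- 2).
      by rewrite -[x ^- 2]opprK; exact: is_deriveN.
    exact: (is_derive1_comp (is_derive_expR _) dN).
  apply: (@near_eq_is_derive R R R ((fun y : R => p.[y^-1]) * (fun y : R => expR (- y^-1)))).
    near=> y; rewrite /flat; have -> // : 0 < y by near: y; exact: lt_nbhsr.
  apply: is_derive_eq.
  rewrite !hornerE /= !scaleRE exprVn; ring.
- have fl0 q : flat q 0 = 0 by rewrite /flat ltxx.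
  rewrite fl0.
  have [C C0 HC] := poly_le_expR p 2.
  have lim : h^-1 *: ((flat p \o shift 0) (h *: 1) - flat p 0) @[h --> 0^'] --> (0 : R).
    apply/cvgrPdist_le => e e0; near=> h.
    have h0 : h != 0 by near: h; exact: nbhs_dnbhs_neq.
    rewrite fl0 subr0 sub0r normrN /= addr0 [h *: 1]mulr1 /flat.
    case: ifPn => [hp|_]; last by rewrite scaler0 normr0 ltW.
    have h1 : h <= 1.
      by rewrite -[h]ger0_norm ?(ltW hp) //; near: h; exact: dnbhs0_le.
    have he : `|h| <= e / (C + 1).
      by near: h; apply: dnbhs0_le; rewrite divr_gt0 // ltr_wpDl.
    have u1 : 1 <= h^-1 by rewrite invf_ge1.
    have := HC _ u1; rewrite expRN scaleRE.
    rewrite normrM normrM [`|(expR _)^-1|]ger0_norm ?invr_ge0 ?expR_ge0 //.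
    rewrite [`|h^-1|]ger0_norm ?invr_ge0 ?(ltW hp) // => H.
    move: he; rewrite (ger0_norm (ltW hp)) => he.
    have E := expR_gt0 h^-1.
    rewrite mulrA ler_pdivrMr //.
    have -> : h^-1 * `|p.[h^-1]| = h * (`|p.[h^-1]| * h^-1 ^+ 2) by field.
    apply: (@le_trans _ _ (h * (C * expR h^-1))); first by rewrite ler_pM2l.
    rewrite mulrA ler_pM2r //.
    move: he; rewrite ler_pdivlMr ?ltr_wpDl // => he.
    apply: le_trans he; rewrite ler_pM2l //; lra.
  split; first by apply/cvg_ex; exists 0.
  exact: cvg_lim lim.
Unshelve. all: by end_near. Qed.

Lemma Ck_flat k p (U : set R) : open U -> Ck k U (flat p).
Proof.
move=> oU; elim: k p => [|k IH] p.
  split => // x _; apply: differentiable_continuous; apply/derivable1_diffP.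
  by case: (is_derive_flat p x).
have d x v : is_derive x v (flat p) (v * flat ('X^2 * (p - p^`())) x).
  have [d1 <-] := is_derive_flat p x.
  by have := is_derive_dirZ v d1; rewrite [v *: 1]mulr1.
split.
  move=> x _; apply: differentiable_continuous; apply/derivable1_diffP.
  by case: (is_derive_flat p x).
move=> v; split=> [x _|]; first by case: (d x v).
apply: (Ck_eq oU (f := cst v * flat ('X^2 * (p - p^`())))).
  by move=> x _; case: (d x v).
by apply: CkM => //; exact: Ck_cst.
Qed.

Lemma continuous_affine_at (T : topologicalType) (u : T -> R) x (a b c d : R) :
  {for x, continuous u} -> {for x, continuous (fun z => a + c * (u z - b) / d)}.
Proof.
move=> cu; apply: cvgD; first exact: cvg_cst.
by apply: cvgMr_tmp; apply: cvgMl_tmp; apply: cvgB => //; exact: cvg_cst.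
Qed.

Variable n : nat.
Implicit Types (x z : 'rV[R]_n) (r : R).

Definition boxbump x r z : R := \prod_j
  (flat (expR 1 : R)%:P (1 + (z 0 j - x 0 j) / r) *
   flat (expR 1 : R)%:P (1 - (z 0 j - x 0 j) / r)).

Lemma boxbump_center x r : boxbump x r x = 1.
Proof.
apply: big1 => j _; rewrite subrr mul0r addr0 subr0 /flat ltr01 hornerC invr1.
have E : expR 1 * expR (- 1) = 1 :> R by rewrite -expRD subrr expR0.
by rewrite !E mulr1.
Qed.

Lemma boxbump_out x r z : 0 < r -> r <= `|z - x| -> boxbump x r z = 0.
Proof.
move=> r0 rz.
have [j jr] : exists j, r <= `|z 0 j - x 0 j|.
  apply: contrapT => no; suff : `|z - x| < r by rewrite ltNge rz.
  apply: norm_lt_coord => // j; rewrite !mxE ltNge.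
  by apply/negP => jr; apply: no; exists j.
rewrite /boxbump (bigD1 j) //=; set t := (_ - _) in jr *.
suff -> : flat (expR 1 : R)%:P (1 + t / r) * flat (expR 1 : R)%:P (1 - t / r) = 0.
  by rewrite mul0r.
move: jr; rewrite /flat ler_normr => /orP[jr|jr].
  have -> : (0 < 1 - t / r) = false.
    by apply/negbTE; rewrite -leNgt subr_le0 ler_pdivlMr ?mul1r.
  by rewrite mulr0.
have -> : (0 < 1 + t / r) = false.
  by apply/negbTE; rewrite -leNgt -lerBrDl sub0r lerNr -mulNr ler_pdivlMr ?mul1r.
by rewrite mul0r.
Qed.

Lemma continuous_coord (j : 'I_n) : continuous (fun z => z 0 j).
Proof. exact: coord_continuous. Qed.

Lemma smooth_boxbump x r k (U : set 'rV[R]_n) : open U -> Ck k U (boxbump x r).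
Proof.
move=> oU.
have fac (c : R) j : Ck k U (fun z => flat (expR 1 : R)%:P (1 + c * (z 0 j - x 0 j) / r)).
  apply: (@Ck_sub _ _ _ setT) => //.
  apply: (@Ck_affine _ _ _ setT k (fun z => 1 + c * (z 0 j - x 0 j) / r)
    (fun v => c * v 0 j / r)).
  - by move=> z; apply: continuous_affine_at; exact: continuous_coord.
  - by move=> h v y; rewrite !mxE scaleRE; ring.
  - by apply: Ck_flat; exact: openT.
rewrite (_ : boxbump x r = fun z => \prod_(j <- index_enum 'I_n)
  (flat (expR 1 : R)%:P (1 + 1 * (z 0 j - x 0 j) / r) *
   flat (expR 1 : R)%:P (1 + (- 1) * (z 0 j - x 0 j) / r))); last first.
  by apply/funext => z; apply: eq_bigr => j _; rewrite mul1r mulN1r mulNr.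
elim: (index_enum _) => [|j s IH].
  by apply: (Ck_eq oU) (Ck_cst U k (1 : R)) => z _; rewrite big_nil.
apply: (Ck_eq oU) (CkM oU (CkM oU (fac 1 j) (fac (-1) j)) IH) => z _.
by rewrite big_cons.
Qed.

End Bump.

Section Integrals01.
Variable R : realType.
Implicit Types (h : R -> R) (e : R).
Notation mu := (@lebesgue_measure R).

Definition cont01 h := forall s : R, 0 <= s <= 1 -> {for s, continuous h}.

Lemma cont01_within h : cont01 h -> {within `[0, 1], continuous h}.
Proof.
move=> ch; apply: continuous_in_subspaceT => s.
by rewrite inE /= in_itv /= => /ch.
Qed.

Lemma cont01_integrable h : cont01 h -> mu.-integrable `[0, 1] (EFin \o h).
Proof.
move/cont01_within => ch.
by apply: continuous_compact_integrable => //; exact: segment_compact.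
Qed.

Lemma Rintegral01_cst c : \int[mu]_(s in `[0, 1]) c = c.
Proof.
rewrite Rintegral_cst; last exact: measurable_itv.
rewrite -[RHS]mulr1; congr (_ * _).
have E := @lebesgue_measure_itv R `[0, 1]; rewrite /= lte_fin ltr01 sube0 in E.
exact: (congr1 fine E).
Qed.

Lemma Rintegral01_le h e : cont01 h -> (forall s, 0 <= s <= 1 -> `|h s| <= e) ->
  `|\int[mu]_(s in `[0, 1]) h s| <= e.
Proof.
move=> ch he; have ih := cont01_integrable ch.
have m01 : measurable (`[0, 1]%classic : set (measurableTypeR R)).
  exact: measurable_itv.
apply: le_trans (le_normr_Rintegral m01 ih) _.
apply: (@le_trans _ _ (\int[mu]_(s in `[0, 1]) e)); last first.
  by rewrite Rintegral01_cst.
apply: le_Rintegral => //.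
  apply: (@cont01_integrable (fun s => `|h s|)) => s s01.
  by apply: continuous_comp; [exact: ch | exact: norm_continuous].
by apply: (@cont01_integrable (cst e)) => s _; exact: cst_continuous.
Qed.

Lemma Rintegral01B h1 h2 : cont01 h1 -> cont01 h2 ->
  \int[mu]_(s in `[0, 1]) (h1 s - h2 s) =
  \int[mu]_(s in `[0, 1]) h1 s - \int[mu]_(s in `[0, 1]) h2 s.
Proof.
move=> c1 c2; apply: RintegralB; [exact: measurable_itv| |];
  exact: cont01_integrable.
Qed.

Lemma Rintegral01Z h c : cont01 h ->
  \int[mu]_(s in `[0, 1]) (c * h s) = c * \int[mu]_(s in `[0, 1]) h s.
Proof.
by move=> ch; apply: RintegralZl; [exact: measurable_itv|exact: cont01_integrable].
Qed.

Lemma cont01_sum n (h : 'I_n -> R -> R) :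
  (forall i, cont01 (h i)) -> cont01 (fun s => \sum_i h i s).
Proof. by move=> ch s s01; apply: continuous_sum_at => i; exact: ch. Qed.

Lemma Rintegral01_sum n (h : 'I_n -> R -> R) : (forall i, cont01 (h i)) ->
  \int[mu]_(s in `[0, 1]) (\sum_i h i s) = \sum_i \int[mu]_(s in `[0, 1]) h i s.
Proof.
elim: n h => [|n IH] h ch.
  rewrite big_ord0; under eq_Rintegral do rewrite big_ord0.
  by rewrite Rintegral01_cst.
rewrite big_ord_recl -IH; last by move=> i; exact: ch.
rewrite -RintegralD; [|exact: measurable_itv|exact: cont01_integrable|].
  by apply: eq_Rintegral => s _; rewrite big_ord_recl.
apply: (@cont01_integrable (fun s => \sum_(i < n) h (lift ord0 i) s)).
by apply: cont01_sum => i; exact: ch.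
Qed.

End Integrals01.

Section Radial_integral.
Variables (R : realType) (V : normedModType R) (x0 : V) (U : set V).
Hypothesis oU : open U.
Hypothesis starU : forall z (s : R), U z -> 0 <= s <= 1 -> U (x0 + s *: (z - x0)).
Notation mu := (@lebesgue_measure R).
Implicit Types (f : V -> R) (z v : V) (s : R).

Definition ray z s : V := x0 + s *: (z - x0).

Definition radint m f z : R := \int[mu]_(s in `[0, 1]) (s ^+ m * f (ray z s)).

Lemma ray_continuous : continuous (fun p : R * V => ray p.2 p.1).
Proof.
move=> p; apply: cvgD; first exact: cvg_cst.
by apply: cvgZ; [exact: cvg_fst | apply: cvgB; [exact: cvg_snd | exact: cvg_cst]].
Qed.

Lemma ray_continuous1 z : continuous (ray z).
Proof.
move=> s; apply: cvgD; first exact: cvg_cst.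
by apply: cvgZr_tmp; exact: cvg_id.
Qed.

Lemma cont01_ray m f z : {in U, continuous f} -> U z ->
  cont01 (fun s => s ^+ m * f (ray z s)).
Proof.
move=> cf Uz s s01; apply: cvgM; first exact: exprn_continuous.
apply: continuous_comp; first exact: ray_continuous1.
by apply: cf; rewrite inE; exact: starU.
Qed.

Lemma near_ray f z (e : R) : {in U, continuous f} -> U z -> 0 < e ->
  \forall y \near z, forall s, 0 <= s <= 1 -> `|f (ray z s) - f (ray y s)| <= e.
Proof.
move=> cf Uz e0.
have cov := (compact_near_coveringP _).1 (@segment_compact R 0 1) V (nbhs z)
  (fun y s => `|f (ray z s) - f (ray y s)| <= e) _.
have H : \forall y \near z, `[0, 1] `<=` (fun s => `|f (ray z s) - f (ray y s)| <= e).
  apply: cov => s; rewrite /= in_itv /= => s01.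
  have Us : ray z s \in U by rewrite inE; exact: starU.
  have e20 : 0 < e / 2 by rewrite divr_gt0.
  have c2 : {for (s, z), continuous (fun p : R * V => f (ray p.2 p.1))}.
    apply: (@continuous_comp _ _ _ (fun p : R * V => ray p.2 p.1) f).
      exact: ray_continuous.
    exact: cf.
  have c1 : {for s, continuous (fun t => f (ray z t))}.
    by apply: continuous_comp; [exact: ray_continuous1 | exact: cf].
  have /cvgrPdist_le/(_ _ e20) [/= [A B] [/= Az Bz] AB] := c2.
  have /cvgrPdist_le/(_ _ e20) /= N1 := c1.
  exists (A `&` [set t | `|f (ray z s) - f (ray z t)| <= e / 2], B).
    by split => //=; apply: filterI.
  move=> [t y] /= [[At Ht] By].
  have := AB (t, y) (conj At By) => /= Hty.
  rewrite [e]splitr -[X in `|X|](subrKA (f (ray z s))).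
  apply: le_trans (ler_normD _ _) _; rewrite lerD // distrC //.
by near=> y => s s01; apply: (near H y) => //=; rewrite in_itv.
Unshelve. all: by end_near. Qed.

Lemma radint_continuous m f z : {in U, continuous f} -> U z ->
  {for z, continuous (radint m f)}.
Proof.
move=> cf Uz; apply/cvgrPdist_le => e e0.
have nU : \forall y \near z, U y by exact: open_nbhs_nbhs.
near=> y.
have Uy : U y by near: y; exact: nU.
rewrite /radint -Rintegral01B; [|exact: cont01_ray|exact: cont01_ray].
apply: Rintegral01_le.
  move=> s s01; apply: cvgB; exact: cont01_ray.
move=> s s01; rewrite -mulrBr normrM.
have /andP[s0 s1] := s01.
have H : `|f (ray z s) - f (ray y s)| <= e.
  by move: s s01 {s0 s1}; near: y; exact: near_ray.
apply: le_trans H; rewrite ler_piMl // ger0_norm ?exprn_ge0 //.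
by rewrite exprn_ile1.
Unshelve. all: by end_near. Qed.

Lemma rayD z v (h : R) s : ray (h *: v + z) s = ray z s + (s * h) *: v.
Proof.
by rewrite /ray -addrA [X in _ *: X]addrC scalerDr scalerA -addrA.
Qed.

Lemma is_derive_radint m f z v : {in U, continuous f} ->
  (forall x, U x -> derivable f x v) -> {in U, continuous ('D_v f)} -> U z ->
  is_derive z v (radint m f) (radint m.+1 ('D_v f) z).
Proof.
move=> cf df cD Uz.
suff lim : h^-1 *: ((radint m f \o shift z) (h *: v) - radint m f z) @[h --> 0^'] -->
    radint m.+1 ('D_v f) z.
  split; first by apply/cvg_ex; eexists; exact: lim.
  exact: cvg_lim lim.
apply/cvgrPdist_le => e e0.
have nUD : \forall y \near z, U y /\
    forall s, 0 <= s <= 1 -> `|'D_v f (ray z s) - 'D_v f (ray y s)| <= e.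
  by apply: filterI; [exact: open_nbhs_nbhs | exact: (near_ray cD Uz e0)].
have nh : \forall h \near (0 : R), forall t : R, 0 <= t <= 1 ->
    U ((t * h) *: v + z) /\
    forall s, 0 <= s <= 1 -> `|'D_v f (ray z s) - 'D_v f (ray ((t * h) *: v + z) s)| <= e.
  have /nbhs_ballP[r /= r0 rP] := nUD.
  have nb : \forall h \near (0 : R), `|h| < r / (`|v| + 1).
    by apply: nbhs0_lt; rewrite divr_gt0 // ltr_wpDl.
  near=> h => t /andP[t0 t1]; apply: rP.
  rewrite -ball_normE /ball_ /= opprD addrCA subrr addr0 normrN normrZ.
  apply: (@le_lt_trans _ _ (`|h| * `|v|)).
    by rewrite ler_wpM2r // normrM ler_piMl // ger0_norm.
  apply: (@le_lt_trans _ _ (`|h| * (`|v| + 1))); first by rewrite ler_wpM2l // lerDl.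
  by rewrite -ltr_pdivlMr ?ltr_wpDl //; near: h; exact: nb.
near=> h.
have h0 : h != 0 by near: h; exact: nbhs_dnbhs_neq.
have hP : forall t : R, 0 <= t <= 1 -> U ((t * h) *: v + z) /\
    forall s, 0 <= s <= 1 -> `|'D_v f (ray z s) - 'D_v f (ray ((t * h) *: v + z) s)| <= e.
  by near: h; exact: nbhs_dnbhs.
have Uh : U (h *: v + z) by have := hP 1; rewrite mul1r ler01 lexx => /(_ isT)[].
have c1 := cont01_ray (m := m) cf Uh; have c2 := cont01_ray (m := m) cf Uz.
have c3 := cont01_ray (m := m.+1) cD Uz.
have c12 : cont01 (fun s => s ^+ m * f (ray (h *: v + z) s) - s ^+ m * f (ray z s)).
  by move=> s s01; apply: cvgB; [exact: c1|exact: c2].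
have c12h : cont01 (fun s => h^-1 * (s ^+ m * f (ray (h *: v + z) s) - s ^+ m * f (ray z s))).
  by move=> s s01; apply: cvgMl_tmp; exact: c12.
rewrite scaleRE /radint /= -(Rintegral01B c1 c2) -(Rintegral01Z _ c12) -(Rintegral01B c3 c12h).
apply: Rintegral01_le; first by move=> s s01; apply: cvgB; [exact: c3|exact: c12h].
move=> s s01; have /andP[s0 s1] := s01.
rewrite -mulrBr rayD.
have [|t t01] := @MVT_line R V f (ray z s) ((s * h) *: v).
  move=> t t01; rewrite scalerA mulrCA -(rayD z v (t * h) s).
  have [|d _] := is_derive_dirZ (s * h) (df (ray ((t * h) *: v + z) s) _) => //.
  by apply: starU => //; have [] := hP t t01.
rewrite scalerA mulrCA -(rayD z v (t * h) s) => ->.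
have [|_ ->] := is_derive_dirZ (s * h) (df (ray ((t * h) *: v + z) s) _).
  by apply: starU => //; have [] := hP t t01.
set D1 := 'D_v f _; set D2 := 'D_v f _.
have -> : s ^+ m.+1 * D1 - h^-1 * (s ^+ m * (s * h * D2)) = s ^+ m.+1 * (D1 - D2).
  by rewrite exprS; field.
rewrite normrM; have [_ /(_ s s01) H] := hP t t01.
apply: le_trans H; rewrite ler_piMl // ger0_norm ?exprn_ge0 //.
by rewrite exprn_ile1.
Unshelve. all: by end_near. Qed.

Lemma Ck_radint k m f : Ck k U f -> Ck k U (radint m f).
Proof.
elim: k m f => [|k IH] m f Cf.
  split => // z Uz; apply: radint_continuous => // x; rewrite inE => Ux.
  exact: Ck_continuous Cf Ux.
have cf : {in U, continuous f} by move=> x; rewrite inE => Ux; exact: Ck_continuous Cf Ux.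
split; first by move=> z Uz; exact: radint_continuous.
move=> v; have [_ df] := Cf; have [dv Cv] := df v.
have cD : {in U, continuous ('D_v f)}.
  by move=> x; rewrite inE => Ux; exact: Ck_continuous Cv Ux.
have dI z : U z -> is_derive z v (radint m f) (radint m.+1 ('D_v f) z).
  by move=> Uz; exact: is_derive_radint.
split; first by move=> z /dI[].
by apply: (Ck_eq oU) (IH m.+1 _ Cv) => z /dI[].
Qed.

Lemma radint_center f : radint 0 f x0 = f x0.
Proof.
rewrite -[RHS](Rintegral01_cst (f x0)); apply: eq_Rintegral => s _.
by rewrite expr0 mul1r /ray subrr scaler0 addr0.
Qed.

Lemma radint_FTC f z : {in U, continuous f} ->
  (forall x, U x -> derivable f x (z - x0)) ->
  {in U, continuous ('D_(z - x0) f)} -> U z ->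
  f z - f x0 = radint 0 ('D_(z - x0) f) z.
Proof.
move=> cf df cD Uz.
have c0 := cont01_ray (m := 0) cD Uz.
have cF : cont01 (fun s => f (ray z s)).
  move=> s s01; apply: continuous_comp; first exact: ray_continuous1.
  by apply: cf; rewrite inE; exact: starU.
have dF s : 0 <= s <= 1 -> is_derive s 1 (fun s => f (ray z s)) ('D_(z - x0) f (ray z s)).
  by move=> s01; apply: is_derive_line; apply: df; exact: starU.
have := @continuous_FTC2 R (fun s => s ^+ 0 * 'D_(z - x0) f (ray z s))
  (fun s => f (ray z s)) 0 1 ltr01 (cont01_within c0) _ _.
rewrite /radint /Rintegral => -> //.
- have -> : ray z 1 = z by rewrite /ray scale1r addrC subrK.
  by rewrite /ray scale0r addr0.
- split.
  + move=> s; rewrite in_itv/= => /andP[s0 s1].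
    by case: (dF s) => //; rewrite !ltW.
  + by apply: cvg_at_right_filter; apply: cF; rewrite lexx ler01.
  + by apply: cvg_at_left_filter; apply: cF; rewrite lexx ler01.
- move=> s; rewrite in_itv/= => /andP[s0 s1].
  by rewrite derive1E expr0 mul1r; case: (dF s) => //; rewrite !ltW.
Qed.

End Radial_integral.

Lemma hadamard (R : realType) n (x0 : 'rV[R]_n) (U : set 'rV[R]_n)
    (f : 'rV[R]_n -> R) : open U -> 
  (forall z (s : R), U z -> 0 <= s <= 1 -> U (x0 + s *: (z - x0))) ->
  smooth_on U f -> U x0 ->
  exists g : 'I_n -> 'rV[R]_n -> R,
    [/\ forall j, smooth_on U (g j),
        forall z, U z -> f z = f x0 + \sum_j (z 0 j - x0 0 j) * g j z
      & forall j, g j x0 = 'D_(delta_mx 0 j) f x0].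
Proof.
move=> oU sU sf Ux0.
have Cv k v : Ck k U ('D_v f) by have [_ df] := sf k.+1; have [] := df v.
have dv v x : U x -> derivable f x v.
  by have [_ df] := sf 1%N; have [+ _] := df v; apply.
have cv v : {in U, continuous ('D_v f)}.
  by move=> x; rewrite inE; exact: Ck_continuous (Cv 0%N v).
exists (fun j => radint x0 0 ('D_(delta_mx 0 j) f)); split.
- by move=> j k; apply: Ck_radint => //; exact: Cv.
- move=> z Uz; apply/eqP; rewrite addrC -subr_eq; apply/eqP.
  rewrite (@radint_FTC R _ x0 U) //; last first.
  + exact: dv.
  + by move=> x; rewrite inE; exact: (Ck_continuous (sf 0%N)).
  rewrite /radint.
  have cj (j : 'I_n) : cont01 (fun s => s ^+ 0 * 'D_(delta_mx 0 j) f (ray x0 z s)).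
    exact: (cont01_ray (m := 0) sU (cv (delta_mx 0 j)) Uz).
  rewrite (eq_bigr (fun j => \int[lebesgue_measure]_(s in `[0, 1])
     ((z 0 j - x0 0 j) * (s ^+ 0 * 'D_(delta_mx 0 j) f (ray x0 z s))))); last first.
    by move=> j _; rewrite Rintegral01Z.
  rewrite -Rintegral01_sum; last by move=> j s s01; apply: cvgMl_tmp; exact: cj.
  apply: eq_Rintegral => s; rewrite inE /= in_itv /= => s01.
  have Us := sU z s Uz s01.
  rewrite expr0 mul1r deriveE; last exact: (C1_differentiable oU Us (sf 1%N)).
  rewrite {1}[z - x0]row_sum_delta linear_sum; apply: eq_bigr => j _.
  rewrite linearZ !mxE mul1r -deriveE //.
  exact: (C1_differentiable oU Us (sf 1%N)).
- by move=> j; rewrite radint_center.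
Qed.

(** * Derivations on a manifold *)

Lemma is_derive_affine (R : realType) (V : normedModType R) (f : V -> R) x v l :
  (forall h : R, f (h *: v + x) = h * l + f x) -> is_derive x v f l.
Proof.
move=> fE; suff lim : h^-1 *: ((f \o shift x) (h *: v) - f x) @[h --> 0^'] --> l.
  by split; [apply/cvg_ex; exists l | exact: cvg_lim lim].
apply/cvgrPdist_le => e e0; near=> h.
have h0 : h != 0 by near: h; exact: nbhs_dnbhs_neq.
by rewrite /= fE addrK scaleRE mulKf // subrr normr0 ltW.
Unshelve. all: by end_near. Qed.

Lemma open_setI_preimage (S T : topologicalType) (U : set S) (f : S -> T) (B : set T) :
  open U -> (forall x, U x -> {for x, continuous f}) -> open B ->
  open (U `&` f @^-1` B).
Proof.
move=> oU cf oB; rewrite openE => x [Ux Bfx].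
apply: filterI; first exact: open_nbhs_nbhs.
by apply: (cf x Ux); exact: open_nbhs_nbhs.
Qed.

Section Smooth_functions.
Variables (R : realType) (n : nat) (M : manifold R n).
Implicit Types (f h : C^oo(M)) (X Y : X^oo(M)) (p q : M) (c : chart R M n).

Lemma smoothf_eqP f h : f =1 h <-> f = h.
Proof. by split=> [fh|->//]; apply: val_inj; apply/funext. Qed.

Lemma smoothfD f h p : (f + h) p = f p + h p. Proof. by []. Qed.
Lemma smoothfM f h p : (f * h) p = f p * h p. Proof. by []. Qed.
Lemma smoothfN f p : (- f) p = - f p. Proof. by []. Qed.
Lemma smoothf0 p : (0 : C^oo(M)) p = 0. Proof. by []. Qed.
Lemma smoothf1 p : (1 : C^oo(M)) p = 1. Proof. by []. Qed.
Lemma scstE (r : R) p : scst M r p = r. Proof. by []. Qed.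

Lemma smoothf_sum (I : Type) (r : seq I) (P : pred I) (F : I -> C^oo(M)) p :
  (\sum_(i <- r | P i) F i) p = \sum_(i <- r | P i) F i p.
Proof. by elim/big_rec2: _ => // i y1 y2 _ <-. Qed.

Lemma vfP X : is_derivation X.
Proof. exact/asboolP/vfunP. Qed.

Lemma vfD X f h : X (f + h) = X f + X h. Proof. by have [+ _ _] := vfP X; apply. Qed.
Lemma vfZ X r f : X (scst M r * f) = scst M r * X f. Proof. by have [_ + _] := vfP X; apply. Qed.
Lemma vfM X f h : X (f * h) = X f * h + f * X h. Proof. by have [_ _ +] := vfP X; apply. Qed.
Lemma vf0 X : X 0 = 0.
Proof. by apply: (addrI (X 0)); rewrite -vfD !addr0. Qed.
Lemma vf_sum X (I : Type) (r : seq I) (P : pred I) (F : I -> C^oo(M)) :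
  X (\sum_(i <- r | P i) F i) = \sum_(i <- r | P i) X (F i).
Proof.
elim/big_rec2: _ => [|i y1 y2 _ <-]; [exact: vf0 | exact: vfD].
Qed.

Lemma vf_eqP X Y : (forall f p, X f p = Y f p) <-> X = Y.
Proof.
split=> [XY|->//]; apply: val_inj; apply/funext => f; apply/smoothf_eqP => p.
exact: XY.
Qed.

Lemma vfaddE X Y f p : (X + Y) f p = X f p + Y f p. Proof. by []. Qed.
Lemma vfoppE X f p : (- X) f p = - X f p. Proof. by []. Qed.
Lemma vf0E f p : (0 : X^oo(M)) f p = 0. Proof. by []. Qed.
Lemma vfscaleE h X f p : (h *: X) f p = h p * X f p. Proof. by []. Qed.
Lemma vfsumE (I : Type) (r : seq I) (P : pred I) (F : I -> X^oo(M)) f p :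
  (\sum_(i <- r | P i) F i) f p = \sum_(i <- r | P i) F i f p.
Proof. by elim/big_rec2: _ => // i y1 y2 _ <-. Qed.

Lemma liebE X Y f p : lieb X Y f p = X (Y f) p - Y (X f) p. Proof. by []. Qed.

Lemma vf_scst X (r : R) : X (scst M r) = 0.
Proof.
have X1 : X 1 = 0.
  by apply: (addrI (X 1)); rewrite -[in RHS](mulr1 1) vfM mulr1 mul1r addr0.
by rewrite -[scst M r]mulr1 vfZ X1 mulr0.
Qed.

Lemma smoothfunP f : smooth f. Proof. exact/asboolP/sfunP. Qed.

Lemma cinvK c x : (cmap c @` cdom c) x -> cdom c (cinv c x) /\ cmap c (cinv c x) = x.
Proof. by case=> q cq <-; rewrite cmapK. Qed.

Lemma open_chart_preimage c (B : set M) : open B ->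
  open ((cmap c @` cdom c) `&` cinv c @^-1` B).
Proof.
apply: open_setI_preimage; first exact: cim_open.
by move=> x cx; exact: cinv_continuous.
Qed.

Lemma chart_extension c (U : set 'rV[R]_n) (x0 : 'rV[R]_n) (r : R)
    (g : 'rV[R]_n -> R) : atlas c -> open U -> U `<=` cmap c @` cdom c -> 0 < r ->
  (forall z, `|z - x0| <= r -> U z) -> smooth_on U g ->
  exists F : C^oo(M),
    (forall q, cdom c q -> F q = boxbump x0 r (cmap c q) * g (cmap c q)) /\
    (forall q, ~ cdom c q -> F q = 0).
Proof.
move=> ac oU Uc r0 rU sg.
pose h z := boxbump x0 r z * g z.
have oC : open [set z : 'rV[R]_n | r < `|z - x0|].
  apply: (@open_comp _ _ (fun z : 'rV[R]_n => `|z - x0|) [set t | r < t]).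
    move=> z _; apply: continuous_comp; last exact: norm_continuous.
    by apply: continuousB; [exact: cvg_id | exact: cst_continuous].
  exact: open_gt.
have Ch k : Ck k (cmap c @` cdom c) h.
  apply: Ck_local => x cx; have [xr|xr] := leP `|x - x0| r.
    exists U; first exact: rU.
    by apply: (@CkM _ _ U oU k (boxbump x0 r) g); [exact: smooth_boxbump | exact: sg].
  exists [set z : 'rV[R]_n | r < `|z - x0|] => //.
  apply: (Ck_eq oC) (Ck_cst _ k 0) => z /= /ltW zr.
  by rewrite /h boxbump_out // mul0r.
pose F q : R := if `[< cdom c q >] then h (cmap c q) else 0.
pose K := cinv c @` [set z : 'rV[R]_n | `|z - x0| <= r].
have Kc : K `<=` cdom c by move=> q [z /rU/Uc/cinvK[+ _]] <-.
have clK : closed K.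
  apply: compact_closed; first exact: points_hausdorff.
  apply: continuous_compact.
    apply: continuous_in_subspaceT => z; rewrite inE => /rU/Uc.
    exact: cinv_continuous.
  apply: bounded_closed_compact.
    exists (`|x0| + r); split; first exact: num_real.
    move=> t tr z /= zr; rewrite -(subrK x0 z); apply: le_trans (ler_normD _ _) _.
    by rewrite addrC; apply/ltW/(le_lt_trans _ tr); rewrite lerD2l.
  rewrite (_ : [set z | _] = ~` [set z : 'rV[R]_n | r < `|z - x0|]).
    exact: open_closedC.
  by apply/seteqP; split => z /=; rewrite leNgt => /negP.
have sF : smooth F.
  move=> d ad k; apply: Ck_local => y dy; have [dq qy] := cinvK dy.
  have [cq|ncq] := pselect (cdom c (cinv d y)).
    have oN := open_chart_preimage (c := d) (cdom_open c).
    exists ((cmap d @` cdom d) `&` cinv d @^-1` cdom c) => //.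
    apply: (Ck_eq oN (f := h \o (cmap c \o cinv d))).
      by move=> z [_ cz]; rewrite /F /= asboolT.
    have H1 z : ((cmap d @` cdom d) `&` cinv d @^-1` cdom c) z ->
        (cmap c @` cdom c) ((cmap c \o cinv d) z).
      by move=> [_ cz]; exists (cinv d z).
    have H2 : Ck k ((cmap d @` cdom d) `&` cinv d @^-1` cdom c) (cmap c \o cinv d).
      apply: Ck_sub (atlas_compat ad ac k) => z [dz cz].
      by have [dz' zE] := cinvK dz; exists (cinv d z).
    exact: (Ck_comp oN (@cim_open _ _ _ c) H1 (Ch k) H2).
  have oN := open_chart_preimage (c := d) (closed_openC clK).
  exists ((cmap d @` cdom d) `&` cinv d @^-1` ~` K).
    by split => // /Kc.
  apply: (Ck_eq oN) (Ck_cst _ k 0) => z [_ Kz]; rewrite /F /=.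
  case: asboolP => // cz; rewrite /h boxbump_out ?mul0r // leNgt.
  apply/negP => /ltW zr; apply: Kz; exists (cmap c (cinv d z)) => //.
  exact: cmapK.
have sFb : F \in @smooth_pred R n M by apply/asboolP.
exists (SmoothFun sFb); split => q cq; rewrite /= /F; first by rewrite asboolT.
by rewrite asboolF.
Qed.

Lemma smooth_on_chart c f : atlas c -> smooth_on (cmap c @` cdom c) (fun z => f (cinv c z)).
Proof. by move=> ac; exact: smoothfunP. Qed.

Lemma Ck_id (V : normedModType R) (U : set V) k : Ck k U (id : V -> V).
Proof.
case: k => [|k]; split => //; try by move=> x _; exact: cvg_id.
move=> v; split=> [x _|]; first exact: derivable_id.
rewrite (_ : (fun x => _) = cst v); first exact: Ck_cst.
by apply/funext => x; rewrite derive_id.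
Qed.

Lemma smooth_coord (U : set 'rV[R]_n) j (a : R) : open U ->
  smooth_on U (fun z => z 0 j - a).
Proof.
move=> oU k; apply: (@CkB _ _ _ U oU k (fun z : 'rV[R]_n => z 0 j) (cst a)).
  by apply: (@Ck_coord _ _ U n k id) => //; exact: Ck_id.
exact: Ck_cst.
Qed.

Lemma derivation_coords c p : atlas c -> cdom c p ->
  exists y : 'I_n -> C^oo(M),
    (forall X f, X f p = \sum_j X (y j) p *
       'D_(delta_mx 0 j) (fun z => f (cinv c z)) (cmap c p)) /\
    (forall i j, 'D_(delta_mx 0 i) (fun z => y j (cinv c z)) (cmap c p) = (i == j)%:R).
Proof.
move=> ac cp; pose x0 := cmap c p.
have cx0 : (cmap c @` cdom c) x0 by exists p.
have /nbhs_ballP[e /= e0 eU] : nbhs x0 (cmap c @` cdom c).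
  by apply: open_nbhs_nbhs; split => //; exact: cim_open.
pose U : set 'rV[R]_n := ball x0 e.
have oU : open U by exact: ball_open.
have r0 : 0 < e / 2 by rewrite divr_gt0.
have rU z : `|z - x0| <= e / 2 -> U z.
  move=> zr; rewrite /U -ball_normE /ball_ /= distrC; apply: le_lt_trans zr _.
  by rewrite ltr_pdivrMr // mulr2n mulrDr mulr1 ltrDl.
have sU z (s : R) : U z -> 0 <= s <= 1 -> U (x0 + s *: (z - x0)).
  rewrite /U -ball_normE /ball_ /= => zU /andP[s0 s1].
  rewrite opprD addNKr normrN normrZ ger0_norm // distrC.
  by apply: le_lt_trans zU; rewrite distrC ler_piMl.
have Ux0 : U x0 by exact: ballxx.
have ext g := @chart_extension c U x0 (e / 2) g ac oU eU r0 rU.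
have s1 : smooth_on U (cst 1 : 'rV[R]_n -> R) by move=> k; exact: Ck_cst.
have [chi [chi1 chi0]] := ext _ s1.
have /choice[y yP] : forall j, exists F : C^oo(M),
    (forall q, cdom c q -> F q = boxbump x0 (e / 2) (cmap c q) * (cmap c q 0 j - x0 0 j)) /\
    (forall q, ~ cdom c q -> F q = 0).
  by move=> j; exact: ext _ (smooth_coord j (x0 0 j) oU).
exists y; split=> [X f|i j].
  have sf : smooth_on U (fun z => f (cinv c z)).
    by move=> k; apply: Ck_sub eU _; exact: smooth_on_chart.
  have [g [sg fg gD]] := hadamard oU sU sf Ux0.
  have /choice[G GP] : forall j, exists F : C^oo(M),
      (forall q, cdom c q -> F q = boxbump x0 (e / 2) (cmap c q) * g j (cmap c q)) /\
      (forall q, ~ cdom c q -> F q = 0).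
    by move=> j; exact: ext _ (sg j).
  have E : chi * chi * f = scst M (f p) * (chi * chi) + \sum_j y j * G j.
    apply/smoothf_eqP => q; rewrite smoothfD smoothf_sum !smoothfM scstE.
    have [cq|ncq] := pselect (cdom c q); last first.
      rewrite chi0 // !mul0r mulr0 add0r big1 // => j _.
      by rewrite smoothfM (yP j).2 // mul0r.
    rewrite chi1 // mulr1; have [qr|qr] := ltP (e / 2) `|cmap c q - x0|.
      rewrite boxbump_out ?(ltW qr) // !mul0r mulr0 add0r big1 // => j _.
      by rewrite smoothfM (yP j).1 // boxbump_out ?(ltW qr) // !mul0r.
    have := fg _ (rU _ qr); rewrite cmapK // => ->.
    rewrite /x0 cmapK // mulrDr [_ * f p]mulrC; congr (_ + _).
    rewrite mulr_sumr; apply: eq_bigr => j _.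
    by rewrite smoothfM (yP j).1 // (GP j).1 //; ring.
  have := congr1 (fun u : C^oo(M) => X u p) E.
  rewrite vfM vfD vfZ vf_sum !smoothfD !smoothfM scstE smoothf_sum.
  rewrite chi1 // boxbump_center !mul1r [f p * _]mulrC => /addrI ->.
  apply: eq_bigr => j _.
  rewrite vfM smoothfD !smoothfM (yP j).1 // (GP j).1 // subrr mulr0 mul0r addr0.
  by rewrite boxbump_center mul1r gD.
have -> : 'D_(delta_mx 0 i) (fun z => y j (cinv c z)) (cmap c p) =
    'D_(delta_mx 0 i) (boxbump x0 (e / 2) * (fun z => z 0 j - x0 0 j)) x0.
  apply: near_eq_derive.
  have : \forall z \near x0, (cmap c @` cdom c) z.
    by apply: open_nbhs_nbhs; split => //; exact: cim_open.
  apply: filterS => z /cinvK[cz zE].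
  by rewrite (yP j).1 // zE.
have db : derivable (boxbump x0 (e / 2)) x0 (delta_mx 0 i).
  have [_ d] := smooth_boxbump x0 (e / 2) 1 oU.
  by have [+ _] := d (delta_mx 0 i); apply.
have dz : derivable (fun z : 'rV[R]_n => z 0 j - x0 0 j) x0 (delta_mx 0 i).
  have [_ d] := smooth_coord j (x0 0 j) oU 1%N.
  by have [+ _] := d (delta_mx 0 i); apply.
rewrite deriveM // subrr scale0r addr0 boxbump_center scale1r.
have [] // := @is_derive_affine R _ (fun z : 'rV[R]_n => z 0 j - x0 0 j) x0
  (delta_mx 0 i) (i == j)%:R.
by move=> h; rewrite !mxE eqxx [j == i]eq_sym; ring.
Qed.

End Smooth_functions.

(** * Left-invariant vector fields *)

Lemma continuous_pair_at (S T1 T2 : topologicalType) (f : S -> T1) (g : S -> T2) x :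
  {for x, continuous f} -> {for x, continuous g} ->
  {for x, continuous (fun z => (f z, g z))}.
Proof. by move=> cf cg; exact: cvg_pair. Qed.

Lemma continuous_pairl (T1 T2 : topologicalType) (a : T1) :
  continuous (fun z : T2 => (a, z)).
Proof. by move=> z; apply: cvg_pair; [exact: cvg_cst | exact: cvg_id]. Qed.

Lemma continuous_pairr (T1 T2 : topologicalType) (a : T1) :
  continuous (fun z : T2 => (z, a)).
Proof. by move=> z; apply: cvg_pair; [exact: cvg_id | exact: cvg_cst]. Qed.

Section Left_translations.
Variables (R : realType) (n : nat) (G : lieGroup R n).
Implicit Types (f h : C^oo(G)) (X Y W : X^oo(G)) (a p q : G) (c d : chart R G n).
Notation mul := (@lg_mul R n G).
Notation e := (lg_one G).

Lemma lg_mulV_r a : mul a (lg_inv a) = e.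
Proof.
rewrite -[LHS]lg_mul1 -{1}(lg_mulV (lg_inv a)) -lg_mulA [mul _ (mul a _)]lg_mulA.
by rewrite lg_mulV lg_mul1 lg_mulV.
Qed.

Lemma lg_mul1_r a : mul a e = a.
Proof. by rewrite -(lg_mulV a) lg_mulA lg_mulV_r lg_mul1. Qed.

Lemma lg_mulK a p : mul (lg_inv a) (mul a p) = p.
Proof. by rewrite lg_mulA lg_mulV lg_mul1. Qed.

Lemma lg_mulKV a p : mul a (mul (lg_inv a) p) = p.
Proof. by rewrite lg_mulA lg_mulV_r lg_mul1. Qed.

Lemma lg_invK a : lg_inv (lg_inv a) = a.
Proof. by rewrite -[LHS]lg_mul1_r -(lg_mulV a) lg_mulK. Qed.

Definition mul_chart c d f (z : 'rV[R]_n * 'rV[R]_n) : R :=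
  f (mul (cinv c z.1) (cinv d z.2)).

Lemma smooth_mul_chart c d f : atlas c -> atlas d ->
  smooth_on [set z | (cmap c @` cdom c) z.1 /\ (cmap d @` cdom d) z.2]
    (mul_chart c d f).
Proof.
move=> ac ad k; set U := [set z | _].
have oU : open U.
  rewrite (_ : U = setT `&` fst @^-1` (cmap c @` cdom c) `&` snd @^-1` (cmap d @` cdom d)).
    apply: open_setI_preimage; last exact: cim_open.
      apply: open_setI_preimage; [exact: openT| |exact: cim_open].
      by move=> x _; exact: cvg_fst.
    by move=> x _; exact: cvg_snd.
  by apply/seteqP; split => z /= [] => [z1 z2|[_ z1] z2].
pose m (z : 'rV[R]_n * 'rV[R]_n) := mul (cinv c z.1) (cinv d z.2).
have cm z : U z -> {for z, continuous m}.
  move=> [z1 z2].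
  have c1 : {for z, continuous (fun z : 'rV[R]_n * 'rV[R]_n => cinv c z.1)}.
    by apply: (continuous_comp (f := fst)); [exact: cvg_fst | exact: cinv_continuous].
  have c2 : {for z, continuous (fun z : 'rV[R]_n * 'rV[R]_n => cinv d z.2)}.
    by apply: (continuous_comp (f := snd)); [exact: cvg_snd | exact: cinv_continuous].
  have c12 := continuous_pair_at c1 c2.
  exact: (continuous_comp c12 (@lg_mul_continuous _ _ G _)).
apply: Ck_local => z Uz.
have [b ab bz] := atlas_cover (m z).
have oN := open_setI_preimage oU cm (cdom_open b).
exists (U `&` m @^-1` cdom b) => //.
apply: (Ck_eq oN (f := (fun x => f (cinv b x)) \o (fun z => cmap b (m z)))).
  by move=> y [_ mb]; rewrite /= cmapK.
have H1 y : (U `&` m @^-1` cdom b) y -> (cmap b @` cdom b) (cmap b (m y)).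
  by move=> [_ my]; exists (m y).
have H2 : Ck k (U `&` m @^-1` cdom b) (fun z => cmap b (m z)).
  by apply: Ck_sub (lg_mul_smooth ac ad ab k) => y [[]].
exact: (Ck_comp oN (@cim_open _ _ _ b) H1 (smooth_on_chart f ab k) H2).
Qed.

Lemma lshift_subproof a f : (fun p => f (mul a p)) \in @smooth_pred R n G.
Proof.
apply/asboolP => d ad k.
have [c ac ca] := atlas_cover a.
have -> : (fun p => f (mul a p)) \o cinv d = mul_chart c d f \o (fun z => (cmap c a, z)).
  by apply/funext => z /=; rewrite /mul_chart /= cmapK.
apply: (@Ck_sub _ _ _ _ _ _ _ _ (@Ck_affine _ _ _ _ k _ (fun v => (0, v)) _ _ _
  (smooth_mul_chart f ac ad k))).
- by move=> z dz; split => //=; exists a.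
- exact: continuous_pairl.
- by move=> h v y; congr (_, _); rewrite /= scaler0 add0r.
Qed.

Definition lshift a f : C^oo(G) := SmoothFun (lshift_subproof a f).

Lemma lshiftE a f p : lshift a f p = f (mul a p). Proof. by []. Qed.

Lemma lshiftD a f h : lshift a (f + h) = lshift a f + lshift a h.
Proof. exact/smoothf_eqP. Qed.
Lemma lshiftM a f h : lshift a (f * h) = lshift a f * lshift a h.
Proof. exact/smoothf_eqP. Qed.
Lemma lshift_scst a r : lshift a (scst G r) = scst G r.
Proof. exact/smoothf_eqP. Qed.
Lemma lshiftKV a f : lshift (lg_inv a) (lshift a f) = f.
Proof. by apply/smoothf_eqP => p; rewrite !lshiftE lg_mulKV. Qed.

Lemma translateP a X Y : translate a X Y <->
  forall f p, X (lshift a f) p = Y f (mul a p).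
Proof.
split=> [H f p|H f h fh p]; first exact: H.
by rewrite -H; congr (X _ p); apply/smoothf_eqP => q; rewrite fh.
Qed.

Lemma pushforward_subproof a X :
  (fun f => lshift (lg_inv a) (X (lshift a f))) \in @derivation_pred R n G.
Proof.
apply/asboolP; split=> [f h|r f|f h].
- by rewrite lshiftD vfD lshiftD.
- by rewrite lshiftM lshift_scst vfZ lshiftM lshift_scst.
- by rewrite lshiftM vfM lshiftD !lshiftM !lshiftKV.
Qed.

Definition pushforward a X : X^oo(G) := VField (pushforward_subproof a X).

Lemma translate_pushforward a X : translate a X (pushforward a X).
Proof. by apply/translateP => f p; rewrite /= lg_mulK. Qed.

Lemma translate_to a Y : exists X, translate a X Y.
Proof.
exists (pushforward (lg_inv a) Y); apply/translateP => f p.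
by rewrite /= lshiftKV lg_invK.
Qed.

Lemma translate_lieb a X X' Y Y' : translate a X X' -> translate a Y Y' ->
  translate a (lieb X Y) (lieb X' Y').
Proof.
move=> /translateP HX /translateP HY; apply/translateP => f p.
have EX h : X (lshift a h) = lshift a (X' h) by apply/smoothf_eqP => q; rewrite HX.
have EY h : Y (lshift a h) = lshift a (Y' h) by apply/smoothf_eqP => q; rewrite HY.
by rewrite !liebE EX EY HX HY.
Qed.

Lemma translateD a X X' Y Y' : translate a X X' -> translate a Y Y' ->
  translate a (X + Y) (X' + Y').
Proof.
move=> /translateP HX /translateP HY; apply/translateP => f p.
by rewrite !vfaddE HX HY.
Qed.

Lemma translateZ a X X' r : translate a X X' -> translate a (r *~: X) (r *~: X').
Proof.
by move=> /translateP HX; apply/translateP => f p; rewrite !vfscaleE HX.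
Qed.

Lemma left_inv_lieb X Y : left_invariant X -> left_invariant Y -> left_invariant (lieb X Y).
Proof. by move=> HX HY a; exact: translate_lieb. Qed.

Lemma left_inv0 : left_invariant (0 : X^oo(G)).
Proof. by move=> a; apply/translateP => f p; rewrite !vf0E. Qed.

Lemma left_invD X Y : left_invariant X -> left_invariant Y -> left_invariant (X + Y).
Proof. by move=> HX HY a; exact: translateD. Qed.

Lemma left_invZ X r : left_invariant X -> left_invariant (r *~: X).
Proof. by move=> HX a; exact: translateZ. Qed.

Lemma left_invN X : left_invariant X -> left_invariant (- X).
Proof.
move=> HX a; have /translateP HXa := HX a; apply/translateP => f p.
by rewrite !vfoppE HXa.
Qed.

Lemma left_inv_sum (I : Type) (r : seq I) (F : I -> X^oo(G)) :
  (forall i, left_invariant (F i)) -> left_invariant (\sum_(i <- r) F i).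
Proof. by move=> HF; elim/big_rec: _ => [|i Y _ HY]; [exact: left_inv0|exact: left_invD]. Qed.

Lemma left_invE X f p : left_invariant X -> X f p = X (lshift p f) e.
Proof. by move=> HX; have /translateP := HX p => ->; rewrite lg_mul1_r. Qed.

Lemma left_inv_eq X Y : left_invariant X -> left_invariant Y ->
  vf_eq_at e X Y -> X = Y.
Proof.
move=> HX HY XY; apply/vf_eqP => f p.
by rewrite (left_invE _ _ HX) (left_invE _ _ HY) XY.
Qed.

Section Left_invariant_frame.
Variables (c : chart R G n).
Hypotheses (ac : atlas c) (ce : cdom c e).

Lemma derivable_lshift_chart f p (v : 'rV[R]_n) :
  derivable (fun z => lshift p f (cinv c z)) (cmap c e) v.
Proof.
have [_ df] := smooth_on_chart (lshift p f) ac 1.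
by have [+ _] := df v; apply; exists e.
Qed.

Definition lderive (v : 'rV[R]_n) f p : R :=
  'D_v (fun z => lshift p f (cinv c z)) (cmap c e).

Lemma lderive_smooth v f : lderive v f \in @smooth_pred R n G.
Proof.
apply/asboolP => d ad k.
have [_ dF] := smooth_mul_chart f ad ac k.+1.
have [_ CF] := dF (0, v).
have -> : lderive v f \o cinv d =
    (fun z => 'D_(0, v) (mul_chart d c f) z) \o (fun y => (y, cmap c e)).
  apply/funext => y; rewrite /= /lderive /derive.
  have E : (fun h : R => h^-1 *: (((fun z => lshift (cinv d y) f (cinv c z)) \o
        shift (cmap c e)) (h *: v) - lshift (cinv d y) f (cinv c (cmap c e)))) =
      (fun h : R => h^-1 *: ((mul_chart d c f \o shift (y, cmap c e)) (h *: (0, v))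
        - mul_chart d c f (y, cmap c e))).
    by apply/funext => h /=; rewrite /mul_chart /= scaler0 add0r.
  by rewrite E.
apply: (@Ck_sub _ _ _ _ _ _ _ _ (@Ck_affine _ _ _ _ k _ (fun v => (v, 0)) _ _ _ CF)).
- by move=> z dz; split => //=; exists e.
- exact: continuous_pairr.
- by move=> h w y; congr (_, _); rewrite /= scaler0 add0r.
Qed.

Lemma lfield_subproof v :
  (fun f => SmoothFun (lderive_smooth v f)) \in @derivation_pred R n G.
Proof.
have df u q : derivable (fun z => lshift q u (cinv c z)) (cmap c e) v.
  exact: derivable_lshift_chart.
apply/asboolP; split=> [f h|r f|f h]; apply/smoothf_eqP => p.
- rewrite smoothfD /= /lderive.
  by rewrite -(deriveD (df f p) (df h p)).
- rewrite smoothfM /= /lderive -scaleRE.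
  by rewrite -(deriveZ r (df f p)).
- transitivity (lderive v f p * h p + f p * lderive v h p); last by [].
  rewrite [LHS]/= {1}/lderive.
  rewrite (deriveM (df f p) (df h p)).
  rewrite cmapK // !lshiftE lg_mul1_r !scaleRE addrC.
  by rewrite [X in X + _ = _]mulrC.
Qed.

Definition lfield v : X^oo(G) := VField (lfield_subproof v).

Lemma left_inv_lfield v : left_invariant (lfield v).
Proof.
move=> a; apply/translateP => f p; rewrite /= /lderive; congr ('D_v _ _).
by apply/funext => z; rewrite !lshiftE lg_mulA.
Qed.

Lemma lfield_e v f : lfield v f e = 'D_v (fun z => f (cinv c z)) (cmap c e).
Proof.
by rewrite /= /lderive; congr ('D_v _ _); apply/funext => z; rewrite lshiftE lg_mul1.
Qed.

End Left_invariant_frame.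

Lemma left_inv_frame : exists (E : 'I_n -> X^oo(G)) (y : 'I_n -> C^oo(G)),
  [/\ forall i, left_invariant (E i),
      forall i j, E i (y j) e = (i == j)%:R
    & forall X, vf_eq_at e X (\sum_j X (y j) e *~: E j)].
Proof.
have [c ac ce] := atlas_cover e.
have [y [yX yD]] := derivation_coords ac ce.
exists (fun i => lfield ac ce (delta_mx 0 i)), y; split.
- by move=> i; exact: left_inv_lfield.
- by move=> i j; rewrite lfield_e yD.
- move=> X f; rewrite yX vfsumE; apply: eq_bigr => j _.
  by rewrite vfscaleE scstE lfield_e.
Qed.

End Left_translations.

Section Evaluation.
Variables (R : realType) (n : nat) (M : manifold R n).

Definition eval_at (p : M) (f : C^oo(M)) : R := f p.

Lemma eval_at_is_zmod_morphism p : zmod_morphism (eval_at p).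
Proof. by []. Qed.

Lemma eval_at_is_monoid_morphism p : monoid_morphism (eval_at p).
Proof. by []. Qed.

HB.instance Definition _ p := GRing.isZmodMorphism.Build _ _ (eval_at p)
  (eval_at_is_zmod_morphism p).
HB.instance Definition _ p := GRing.isMonoidMorphism.Build _ _ (eval_at p)
  (eval_at_is_monoid_morphism p).

Definition fun_linear (B : X^oo(M) -> C^oo(M)) :=
  forall f X Y, B (f *: X + Y) = f * B X + B Y.

Variable B : X^oo(M) -> C^oo(M).
Hypothesis BL : fun_linear B.

Lemma fun_linear0 : B 0 = 0.
Proof.
by have := BL 1 0 0; rewrite scaler0 addr0 mul1r -[LHS]addr0 => /addrI.
Qed.

Lemma fun_linearZ f X : B (f *: X) = f * B X.
Proof. by rewrite -[f *: X]addr0 BL fun_linear0 addr0. Qed.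

Lemma fun_linearD X Y : B (X + Y) = B X + B Y.
Proof. by rewrite -[X]scale1r BL mul1r scale1r. Qed.

Lemma fun_linearN X : B (- X) = - B X.
Proof. by rewrite -scaleN1r fun_linearZ mulN1r. Qed.

Lemma fun_linear_sum (I : Type) (r : seq I) (F : I -> X^oo(M)) :
  B (\sum_(i <- r) F i) = \sum_(i <- r) B (F i).
Proof.
by elim/big_rec2: _ => [|i x y _ <-]; [exact: fun_linear0 | exact: fun_linearD].
Qed.

End Evaluation.

Section Frame.
Variables (R : realType) (n : nat) (M : manifold R n).
Variables (E : 'I_n -> X^oo(M)) (y : 'I_n -> C^oo(M)) (p : M).
Hypothesis Ey : forall i j, E i (y j) p = (i == j)%:R.

(* All tangent spaces have dimension at most n, so Cramer's rule for the
   matrix E_i (y_j) expresses a multiple of any field W in the E_i; the second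
   factor of the determinant makes the identity trivial where it vanishes. *)
Lemma frame_multiple (W : X^oo(M)) : exists (d : C^oo(M)) (h : 'I_n -> C^oo(M)),
  [/\ d p = 1, d *: W = \sum_i h i *: E i &
      (forall j, W (y j) p = 0) -> forall i, h i p = 0].
Proof.
pose A : 'M[C^oo(M)]_n := \matrix_(i, j) E i (y j).
pose w : 'rV[C^oo(M)]_n := \row_j W (y j).
pose h i := \det A * (w *m \adj A) 0 i.
have Ap : map_mx (eval_at p) A = 1%:M.
  by apply/matrixP => i j; rewrite !mxE /eval_at Ey.
have dp : (\det A) p = 1.
  by have := det_map_mx (eval_at p) A; rewrite Ap det1 => /esym.
exists (\det A * \det A), h; split.
- by rewrite smoothfM dp mulr1.
- apply/vf_eqP => f q; rewrite vfsumE vfscaleE smoothfM.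
  have [c ac cq] := atlas_cover q.
  have [u [uX _]] := derivation_coords ac cq.
  pose D (g : C^oo(M)) (k : 'I_n) : R :=
    'D_(delta_mx 0 k) (fun z => g (cinv c z)) (cmap c q).
  pose m : 'M[R]_n := \matrix_(i, k) E i (u k) q.
  pose J : 'M[R]_n := \matrix_(k, j) D (y j) k.
  pose wk : 'rV[R]_n := \row_k W (u k) q.
  pose t : 'cV[R]_n := \col_k D f k.
  have Aq : map_mx (eval_at q) A = m *m J.
    apply/matrixP => i j; rewrite !mxE /eval_at uX.
    by apply: eq_bigr => k _; rewrite !mxE.
  have wq : map_mx (eval_at q) w = wk *m J.
    apply/matrixP => i j; rewrite !mxE /eval_at uX.
    by apply: eq_bigr => k _; rewrite !mxE.
  have dq : (\det A) q = \det (m *m J).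
    by have := det_map_mx (eval_at q) A; rewrite Aq => ->.
  have hq i : (w *m \adj A) 0 i q = (wk *m J *m \adj (m *m J)) 0 i.
    transitivity (map_mx (eval_at q) (w *m \adj A) 0 i); first by rewrite [RHS]mxE.
    by rewrite map_mxM map_mx_adj Aq wq.
  have Wf : W f q = (wk *m t) 0 0.
    by rewrite uX mxE; apply: eq_bigr => k _; rewrite !mxE.
  have Ef i : E i f q = (m *m t) i 0.
    by rewrite uX mxE; apply: eq_bigr => k _; rewrite !mxE.
  have -> : \sum_i (h i *: E i) f q =
      \det (m *m J) * (wk *m (J *m \adj (m *m J) *m m) *m t) 0 0.
    rewrite -!mulmxA [wk *m _]mulmxA [wk *m J *m _]mulmxA [in RHS]mxE mulr_sumr.
    apply: eq_bigr => i _; rewrite vfscaleE /h smoothfM dq hq Ef -mulrA.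
    by rewrite -!mulmxA.
  rewrite dq -mulrA; have [->|d0] := eqVneq (\det (m *m J)) 0; first by rewrite !mul0r.
  congr (_ * _); rewrite Wf.
  have um : m \in unitmx.
    by move: d0; rewrite det_mulmx mulf_eq0 negb_or => /andP[]; rewrite unitmxE unitfE.
  have -> : J *m \adj (m *m J) *m m = (\det (m *m J))%:M.
    by apply: (can_inj (mulKmx um)); rewrite !mulmxA mul_mx_adj scalar_mxC.
  by rewrite mul_mx_scalar -scalemxAl [RHS]mxE.
- move=> W0 i; rewrite /h smoothfM dp mul1r mxE smoothf_sum big1 // => j _.
  by rewrite smoothfM mxE W0 mul0r.
Qed.

Lemma fun_linear_local (B : X^oo(M) -> C^oo(M)) X Y : fun_linear B ->
  vf_eq_at p X Y -> B X p = B Y p.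
Proof.
move=> BL XY; have [d [h [dp dW h0]]] := frame_multiple (X - Y).
have hp i : h i p = 0 by apply: h0 => j; rewrite vfaddE vfoppE XY subrr.
have : B (d *: (X - Y)) p = 0.
  rewrite dW fun_linear_sum // smoothf_sum big1 // => i _.
  by rewrite fun_linearZ // smoothfM hp mul0r.
rewrite fun_linearZ // smoothfM dp mul1r fun_linearD // fun_linearN // smoothfD smoothfN.
by move/subr0_eq.
Qed.

End Frame.

(** * Almost para-contact metric geometry *)

Section Almost_paracontact.
Variables (R : realType) (n : nat) (M : manifold R n) (s : apcm M).
Implicit Types (X Y Z W : X^oo(M)) (f h : C^oo(M)).
Notation g := (metric s).
Notation phi := (Defs.phi s).
Notation xi := (Defs.xi s).
Notation eta := (Defs.eta s).

Lemma metricC X Y : g X Y = g Y X.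
Proof. by have [+ _ _] := metricP s; apply. Qed.

Lemma metric_linear_l Z : fun_linear (g ^~ Z).
Proof. by have [_ H _] := metricP s; move=> f X Y; exact: H. Qed.

Lemma metricDl X Y Z : g (X + Y) Z = g X Z + g Y Z.
Proof. exact: (fun_linearD (metric_linear_l Z)). Qed.

Lemma metricNl X Z : g (- X) Z = - g X Z.
Proof. exact: (fun_linearN (metric_linear_l Z)). Qed.

Lemma metricZl f X Z : g (f *: X) Z = f * g X Z.
Proof. exact: (fun_linearZ (metric_linear_l Z)). Qed.

Lemma metric0l Z : g 0 Z = 0.
Proof. exact: (fun_linear0 (metric_linear_l Z)). Qed.

Lemma metricDr X Y Z : g Z (X + Y) = g Z X + g Z Y.
Proof. by rewrite !(metricC Z) metricDl. Qed.

Lemma metricNr X Z : g Z (- X) = - g Z X.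
Proof. by rewrite !(metricC Z) metricNl. Qed.

Lemma metricZr f X Z : g Z (f *: X) = f * g Z X.
Proof. by rewrite !(metricC Z) metricZl. Qed.

Lemma metric_nondegenerate X : (forall Y, g X Y = 0) -> X = 0.
Proof.
move=> X0; apply/vf_eqP => f p; have [_ _ nd] := metricP s.
by apply: (nd p) => Y; rewrite X0.
Qed.

Lemma phi_xi : phi xi = 0.
Proof.
set k := eta (phi xi).
have E : phi xi = k *: xi.
  have := congr1 phi (phi_phi s xi).
  rewrite phi_phi linearB [phi (eta xi *: xi)]linearZ /= eta_xi !scale1r subrr => /eqP.
  by rewrite subr_eq0 => /eqP.
have k2 : k * k = 0.
  have := phi_phi s xi; rewrite eta_xi scale1r subrr E linearZ /= E scalerA.
  by move/(congr1 eta); rewrite linear0 linearZ /= eta_xi [_ *: _]mulr1.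
have k0 : k = 0.
  apply/smoothf_eqP => p; have := congr1 (fun f : C^oo(M) => f p) k2.
  by rewrite smoothfM => /eqP; rewrite mulf_eq0 orbb => /eqP.
by rewrite E k0 scale0r.
Qed.

Lemma eta_phi X : eta (phi X) = 0.
Proof.
have := congr1 phi (phi_phi s X).
rewrite phi_phi linearB [phi (eta X *: xi)]linearZ /= phi_xi scaler0 subr0 => /eqP.
rewrite -subr_eq0 addrAC subrr add0r oppr_eq0 => /eqP /(congr1 eta).
by rewrite linearZ linear0 /= eta_xi [_ *: _]mulr1.
Qed.

Lemma metric_xi_phi X : g xi (phi X) = 0.
Proof. by rewrite -etaE eta_phi. Qed.

Lemma phi3 X : phi (phi (phi X)) = phi X.
Proof. by rewrite phi_phi eta_phi scale0r subr0. Qed.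

Lemma phi_skew X Y : g (phi X) Y = - g X (phi Y).
Proof.
have := metric_phi s X (phi Y); rewrite eta_phi mulr0 addr0 => <-.
by rewrite phi_phi metricDr metricNr metricZr [g _ xi]metricC metric_xi_phi mulr0 subr0.
Qed.

Lemma fun_double_inj f h : f + f = h + h -> f = h.
Proof.
move=> E; apply/smoothf_eqP => p; have := congr1 (fun f : C^oo(M) => f p) E.
rewrite !smoothfD; lra.
Qed.

Definition koszul X Y Z : C^oo(M) :=
  X (g Y Z) + Y (g Z X) - Z (g X Y)
  + g (lieb X Y) Z - g (lieb X Z) Y - g (lieb Y Z) X.

Lemma koszulE (D : X^oo(M) -> X^oo(M) -> X^oo(M)) X Y Z :
  X (g Y Z) = g (D X Y) Z + g Y (D X Z) ->
  Y (g Z X) = g (D Y Z) X + g Z (D Y X) ->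
  Z (g X Y) = g (D Z X) Y + g X (D Z Y) ->
  D X Y - D Y X = lieb X Y -> D X Z - D Z X = lieb X Z ->
  D Y Z - D Z Y = lieb Y Z ->
  g (D X Y) Z + g (D X Y) Z = koszul X Y Z.
Proof.
rewrite /koszul => -> -> -> <- <- <-; rewrite !metricDl !metricNl.
rewrite (metricC Y) (metricC Z) (metricC X); ring.
Qed.

Variable nabla : X^oo(M) -> X^oo(M) -> X^oo(M).
Hypothesis LC : levi_civita g nabla.

Lemma nablaDr X Y Y' : nabla X (Y + Y') = nabla X Y + nabla X Y'.
Proof. by have [_ H _ _ _] := LC. Qed.

Lemma nabla0r X : nabla X 0 = 0.
Proof. by apply: (addrI (nabla X 0)); rewrite -nablaDr !addr0. Qed.

Lemma nablaZr X (r : R) Y : nabla X (r *~: Y) = r *~: nabla X Y.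
Proof. by have [_ _ H _ _] := LC; rewrite H vf_scst scale0r add0r. Qed.

Lemma nablaNr X Y : nabla X (- Y) = - nabla X Y.
Proof. by apply: (addrI (nabla X Y)); rewrite -nablaDr !subrr nabla0r. Qed.

Lemma nabla_torsion X Y : nabla X Y - nabla Y X = lieb X Y.
Proof. by have [_ _ _ H _] := LC. Qed.

Lemma nabla_metric X Y Z : X (g Y Z) = g (nabla X Y) Z + g Y (nabla X Z).
Proof. by have [_ _ _ _ H] := LC. Qed.

Lemma nabla_koszul X Y Z : g (nabla X Y) Z + g (nabla X Y) Z = koszul X Y Z.
Proof. by apply: koszulE; rewrite ?nabla_torsion ?nabla_metric. Qed.

Lemma para_kahler_nabla X Y Z : para_kahler_leaves s ->
  leaf_tangent s X -> leaf_tangent s Y -> leaf_tangent s Z ->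
  g (nabla X (phi Y)) Z = - g (nabla X Y) (phi Z).
Proof.
move=> [D [Dt [_ _ _ Dtor Dmet]] Dphi] tX tY tZ.
have Dnabla V W : leaf_tangent s V -> leaf_tangent s W ->
    g (D X V) W = g (nabla X V) W.
  move=> tV tW; apply: fun_double_inj; rewrite nabla_koszul.
  by apply: koszulE; rewrite ?Dtor ?Dmet.
have tphi W : leaf_tangent s (phi W) by exact: eta_phi.
by rewrite -Dnabla // Dphi // phi_skew Dnabla.
Qed.

Lemma curvature_xi X Y Z : weakly_para_cosymplectic s nabla -> leaf_tangent s Z ->
  g (curvature nabla X Y xi) Z = 0.
Proof.
move=> [_ Rphi] tZ; have := Rphi X Y xi.
rewrite phi_xi {1}/curvature !nabla0r subrr sub0r oppr0 => /(congr1 phi).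
rewrite linear0 phi_phi => /esym/eqP; rewrite subr_eq0 => /eqP ->.
by rewrite metricZl -etaE tZ mulr0.
Qed.

End Almost_paracontact.

Lemma liebDl (R : realType) n (M : manifold R n) (X Y Z : X^oo(M)) :
  lieb (X + Y) Z = lieb X Z + lieb Y Z.
Proof.
apply/vf_eqP => f p; rewrite vfaddE !liebE !vfaddE.
have -> : Z ((X + Y) f) = Z (X f) + Z (Y f) by rewrite -vfD.
by rewrite smoothfD opprD addrACA.
Qed.

Lemma lieb_anti (R : realType) n (M : manifold R n) (X Y : X^oo(M)) :
  lieb X Y = - lieb Y X.
Proof. by apply/vf_eqP => f p; rewrite vfoppE !liebE opprB. Qed.

Lemma liebZl (R : realType) n (M : manifold R n) (r : R) (X Z : X^oo(M)) :
  lieb (r *~: X) Z = r *~: lieb X Z.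
Proof.
apply/vf_eqP => f p; rewrite vfscaleE !liebE vfscaleE.
have -> : Z ((r *~: X) f) = scst M r * Z (X f) by rewrite -vfZ.
by rewrite smoothfM scstE mulrBr.
Qed.

Lemma liebNl (R : realType) n (M : manifold R n) (X Z : X^oo(M)) :
  lieb (- X) Z = - lieb X Z.
Proof.
by apply: (addrI (lieb X Z)); rewrite -liebDl !subrr; apply/vf_eqP => f p;
   rewrite liebE !vf0E vf0 subr0.
Qed.

Lemma jacobi (R : realType) n (M : manifold R n) (X Y Z : X^oo(M)) :
  lieb (lieb X Y) Z + lieb (lieb Y Z) X + lieb (lieb Z X) Y = 0.
Proof.
have E (V W U : X^oo(M)) (f : C^oo(M)) : U (lieb V W f) = U (V (W f)) - U (W (V f)).
  have -> : U (lieb V W f) = U (V (W f) + scst M (-1) * W (V f)).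
    congr (U _); apply/smoothf_eqP => q.
    by rewrite liebE smoothfD smoothfM scstE mulN1r.
  rewrite vfD vfZ; apply/smoothf_eqP => q.
  by rewrite !smoothfD smoothfM scstE mulN1r.
apply/vf_eqP => f p; rewrite !vfaddE vf0E !(liebE (lieb _ _)) !E !liebE.
rewrite !smoothfD !smoothfN; ring.
Qed.

Section Left_invariant_structure.
Variables (R : realType) (n : nat) (G : lieGroup R n) (s : apcm G).
Variable nabla : X^oo(G) -> X^oo(G) -> X^oo(G).
Hypotheses (LI : left_invariant_structure s) (LC : levi_civita (metric s) nabla).
Implicit Types (X Y Z W : X^oo(G)).
Notation g := (metric s).
Notation phi := (Defs.phi s).
Notation xi := (Defs.xi s).
Notation e := (lg_one G).

Definition gr X Y : R := g X Y e.

Lemma grC X Y : gr X Y = gr Y X. Proof. by rewrite /gr metricC. Qed.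
Lemma grDl X Y Z : gr (X + Y) Z = gr X Z + gr Y Z.
Proof. by rewrite /gr metricDl smoothfD. Qed.
Lemma grDr X Y Z : gr Z (X + Y) = gr Z X + gr Z Y.
Proof. by rewrite /gr metricDr smoothfD. Qed.
Lemma grNl X Z : gr (- X) Z = - gr X Z.
Proof. by rewrite /gr metricNl smoothfN. Qed.
Lemma grNr X Z : gr Z (- X) = - gr Z X.
Proof. by rewrite /gr metricNr smoothfN. Qed.
Lemma grZl r X Z : gr (r *~: X) Z = r * gr X Z.
Proof. by rewrite /gr metricZl smoothfM. Qed.
Lemma grZr r X Z : gr Z (r *~: X) = r * gr Z X.
Proof. by rewrite /gr metricZr smoothfM. Qed.
Lemma gr0l Z : gr 0 Z = 0. Proof. by rewrite /gr metric0l. Qed.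

Lemma metric_left_inv X Y : left_invariant X -> left_invariant Y ->
  g X Y = scst G (gr X Y).
Proof.
move=> HX HY; apply/smoothf_eqP => p; have [_ _ _ Hg] := LI.
by rewrite scstE (Hg (lg_inv p) X X Y Y) ?lg_mulV.
Qed.

Lemma translate_fun_comp a X X' (f f' : C^oo(G)) p : translate a X X' ->
  (forall q, f q = f' (lg_mul a q)) -> X f p = X' f' (lg_mul a p).
Proof. by move=> HX H; exact: (HX f' f H p). Qed.

Lemma translate_nabla a X X' Y Y' : translate a X X' -> translate a Y Y' ->
  translate a (nabla X Y) (nabla X' Y').
Proof.
move=> HX HY; suff -> : nabla X' Y' = pushforward a (nabla X Y) by exact: translate_pushforward.
have [_ _ _ Hg] := LI.
apply/esym/subr0_eq/(metric_nondegenerate (s := s)) => Z'; rewrite metricDl metricNl.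
have [Z HZ] := translate_to a Z'.
suff H p : g (pushforward a (nabla X Y)) Z' (lg_mul a p) = g (nabla X' Y') Z' (lg_mul a p).
  apply/smoothf_eqP => p; rewrite smoothfD smoothfN -(lg_mulKV a p).
  rewrite H.
  exact: subrr.
rewrite -(Hg a (nabla X Y) _ Z Z' (@translate_pushforward _ _ _ a (nabla X Y)) HZ).
have tg V V' W W' : translate a V V' -> translate a W W' ->
    forall q, g V W q = g V' W' (lg_mul a q) by move=> HV HW q; exact: Hg.
have HK : koszul s X Y Z p = koszul s X' Y' Z' (lg_mul a p).
  rewrite /koszul !smoothfD !smoothfN.
  rewrite (translate_fun_comp p HX (tg _ _ _ _ HY HZ)).
  rewrite (translate_fun_comp p HY (tg _ _ _ _ HZ HX)).
  rewrite (translate_fun_comp p HZ (tg _ _ _ _ HX HY)).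
  rewrite (tg _ _ _ _ (translate_lieb HX HY) HZ).
  rewrite (tg _ _ _ _ (translate_lieb HX HZ) HY).
  by rewrite (tg _ _ _ _ (translate_lieb HY HZ) HX).
move: HK; rewrite -!(nabla_koszul LC) !smoothfD; lra.
Qed.

Lemma left_inv_nabla X Y : left_invariant X -> left_invariant Y ->
  left_invariant (nabla X Y).
Proof. by move=> HX HY a; exact: translate_nabla. Qed.

Lemma left_inv_phi X : left_invariant X -> left_invariant (phi X).
Proof. by move=> HX a; have [H _ _ _] := LI; exact: H. Qed.

Lemma left_inv_xi : left_invariant xi.
Proof. by have [_ H _ _] := LI. Qed.

Lemma gr_nabla_skew X Y Z : left_invariant Y -> left_invariant Z ->
  gr (nabla X Y) Z = - gr (nabla X Z) Y.
Proof.
move=> HY HZ; have := nabla_metric LC X Y Z.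
rewrite metric_left_inv // vf_scst => /(congr1 (fun f : C^oo(G) => f e)).
by rewrite smoothfD [g Y _]metricC => /esym/eqP; rewrite addr_eq0 => /eqP.
Qed.

Lemma fun_linear_at_one (B : X^oo(G) -> C^oo(G)) X Y : fun_linear B ->
  vf_eq_at e X Y -> B X e = B Y e.
Proof.
have [E [y [_ Ey _]]] := left_inv_frame G.
by move=> BL XY; exact: (fun_linear_local Ey BL XY).
Qed.

Lemma gr_local X X' Y : vf_eq_at e X X' -> gr X Y = gr X' Y.
Proof. exact: (fun_linear_at_one (metric_linear_l s Y)). Qed.

Lemma phi_local X X' : vf_eq_at e X X' -> vf_eq_at e (phi X) (phi X').
Proof.
move=> XX' f; apply: (fun_linear_at_one (B := fun X => phi X f)) => // h Y Z.
by rewrite linearP.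
Qed.

Lemma left_inv_extension X : exists2 Y, left_invariant Y & vf_eq_at e X Y.
Proof.
have [E [y [LE _ yX]]] := left_inv_frame G.
exists (\sum_j X (y j) e *~: E j); last exact: yX.
by apply: left_inv_sum => j; exact: left_invZ.
Qed.

Lemma left_inv_nondeg X : left_invariant X ->
  (forall Y, left_invariant Y -> gr X Y = 0) -> X = 0.
Proof.
move=> HX X0; apply: (left_inv_eq HX (@left_inv0 R n G)).
have [_ _ nd] := metricP s; apply: nd => Y.
have [Y' HY' YY'] := left_inv_extension Y.
by rewrite -[LHS]/(gr X Y) grC (gr_local _ YY') grC X0.
Qed.

Lemma gr_sum_l (I : Type) (r : seq I) (F : I -> X^oo(G)) Z :
  gr (\sum_(i <- r) F i) Z = \sum_(i <- r) gr (F i) Z.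
Proof. by rewrite /gr (fun_linear_sum (metric_linear_l s Z)) smoothf_sum. Qed.

Lemma gram_basis (b : n.-tuple X^oo(G)) : (forall i, left_invariant (tnth b i)) ->
  (\matrix_(i, j) gr (tnth b i) (tnth b j) : 'M[R]_n) \in unitmx ->
  lie_algebra_basis b.
Proof.
set Gm : 'M[R]_n := \matrix_(i, j) _ => Lb uG; split => // X HX.
have [E [y [LE _ yX]]] := left_inv_frame G.
have XE Y : left_invariant Y -> Y = \sum_j Y (y j) e *~: E j.
  move=> HY; apply: left_inv_eq => //.
  by apply: left_inv_sum => j; exact: left_invZ.
pose C : 'M[R]_n := \matrix_(i, j) tnth b i (y j) e.
pose H : 'M[R]_n := \matrix_(i, j) gr (E i) (E j).
have GE : Gm = C *m H *m C^T.
  apply/matrixP => i j; rewrite !mxE (XE _ (Lb i)) gr_sum_l.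
  under eq_bigr => k _ do rewrite grZl grC (XE _ (Lb j)) gr_sum_l mulr_sumr.
  rewrite exchange_big; apply: eq_bigr => l _ /=; rewrite !mxE mulr_suml.
  by apply: eq_bigr => k _; rewrite !mxE grZl grC; ring.
have uC : C \in unitmx.
  by move: uG; rewrite GE !unitmx_mul => /andP[/andP[]].
have bE i : tnth b i = \sum_j C i j *~: E j.
  by rewrite {1}(XE _ (Lb i)); apply: eq_bigr => j _; rewrite mxE.
have sumb (c : 'rV[R]_n) : \sum_i c 0 i *~: tnth b i = \sum_j (c *m C) 0 j *~: E j.
  under eq_bigr => i _ do rewrite bE scaler_sumr.
  rewrite exchange_big; apply: eq_bigr => j _ /=.
  under eq_bigr => i _ do rewrite scalerA.
  rewrite -scaler_suml; congr (_ *: _); apply/smoothf_eqP => p.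
  by rewrite scstE mxE smoothf_sum; apply: eq_bigr => i _.
pose x : 'rV[R]_n := \row_j X (y j) e.
exists (x *m invmx C); split.
  rewrite sumb mulmxKV // {1}(XE _ HX).
  by apply: eq_bigr => j _; rewrite mxE.
move=> c Xc; have cG : c *m Gm = \row_j gr X (tnth b j).
  apply/rowP => j; rewrite !mxE Xc gr_sum_l.
  by apply: eq_bigr => i _; rewrite grZl mxE.
have xG : (x *m invmx C) *m Gm = \row_j gr X (tnth b j).
  apply/rowP => j; rewrite !mxE.
  have -> : X = \sum_i (x *m invmx C) 0 i *~: tnth b i.
    rewrite sumb mulmxKV // {1}(XE _ HX).
    by apply: eq_bigr => k _; rewrite mxE.
  by rewrite gr_sum_l; apply: eq_bigr => i _; rewrite grZl !mxE.
by apply: (can_inj (mulmxK uG)); rewrite xG cG.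
Qed.

Lemma gram_separates (b : n.-tuple X^oo(G)) X Y : (forall i, left_invariant (tnth b i)) ->
  (\matrix_(i, j) gr (tnth b i) (tnth b j) : 'M[R]_n) \in unitmx ->
  left_invariant X -> left_invariant Y ->
  (forall i, gr X (tnth b i) = gr Y (tnth b i)) -> X = Y.
Proof.
move=> Lb uG HX HY XY; apply: subr0_eq; apply: left_inv_nondeg => [|Z HZ].
  by apply: left_invD => //; exact: left_invN.
have [_ /(_ Z HZ)[c [-> _]]] := gram_basis Lb uG.
rewrite grC gr_sum_l big1 // => i _.
by rewrite grZl grC grDl grNl XY subrr mulr0.
Qed.

End Left_invariant_structure.

(** * The five-dimensional classification *)

Section Adapted_frame.
Variables (R : realType) (G : lieGroup R 5) (s : apcm G).
Variable nabla : X^oo(G) -> X^oo(G) -> X^oo(G).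
Hypotheses (LI : left_invariant_structure s) (LC : levi_civita (metric s) nabla).
Hypothesis WPC : weakly_para_cosymplectic s nabla.
Hypothesis PKL : para_kahler_leaves s.
Implicit Types (X Y Z W : X^oo(G)).
Notation g := (metric s).
Notation gr := (gr s).
Notation phi := (Defs.phi s).
Notation xi := (Defs.xi s).
Notation e := (lg_one G).

Definition om X Y Z : R := gr (nabla X Y) Z.

(* [x] is [eps xi], which brings the normal form of the shape operator to
   eps = 1; [v3] and [v4] are eigenvectors of phi dual to [v1] and [v2]. *)
Record adapted_frame (sigma : R) (x v1 v2 v3 v4 : X^oo(G)) : Prop := AdaptedFrame {
  af_sigma : sigma = 1 \/ sigma = -1;
  af_inv : [/\ left_invariant x, left_invariant v1, left_invariant v2,
    left_invariant v3 & left_invariant v4];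
  af_phi : [/\ phi x = 0, phi v1 = - v1, phi v2 = v2, phi v3 = v3 & phi v4 = - v4];
  af_xi : exists r : R, x = r *~: xi;
  af_xx : gr x x = 1;
  af_11 : gr v1 v1 = 0; af_12 : gr v1 v2 = 0; af_13 : gr v1 v3 = 1; af_14 : gr v1 v4 = 0;
  af_22 : gr v2 v2 = 0; af_23 : gr v2 v3 = 0; af_24 : gr v2 v4 = 1;
  af_33 : gr v3 v3 = 0; af_34 : gr v3 v4 = 0; af_44 : gr v4 v4 = 0;
  af_shape : forall X, left_invariant X ->
    nabla X x = - (gr X v1 *~: v1 + (sigma * gr X v2) *~: v2) }.

Lemma gr_phi_skew X Y : gr (phi X) Y = - gr X (phi Y).
Proof. by rewrite /gr phi_skew. Qed.

Lemma dual_eigenvector v (l : R) : left_invariant v -> v <> 0 -> l = 1 \/ l = -1 ->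
  phi v = l *~: v ->
  exists w, [/\ left_invariant w, phi w = (- l) *~: w & gr v w = 1].
Proof.
move=> Hv v0 l1 phiv.
have [w Hw vw0] : exists2 w, left_invariant w & gr v w != 0.
  apply: contrapT => no; apply: v0; apply: (left_inv_nondeg (s := s) Hv) => w Hw.
  by apply: contrapT => /eqP vw; apply: no; exists w.
have l2 : l * l = 1 by case: l1 => ->; ring.
have ll : scst G l * scst G l = 1 by apply/smoothf_eqP => p; rewrite smoothfM l2.
have Hp := left_inv_phi LI Hw.
exists ((gr v w + gr v w)^-1 *~: (phi (phi w) - l *~: phi w)); split.
- apply: left_invZ; apply: left_invD; first exact: left_inv_phi.
  by apply: left_invN; exact: left_invZ.
- have -> : scst G (- l) = - scst G l by apply/smoothf_eqP.
  rewrite linearZ linearB linearZ /= phi3 scalerA mulrC -scalerA; congr (_ *: _).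
  by rewrite scalerBr !scaleNr scalerA ll scale1r opprK addrC.
- have vp : gr v (phi w) = - l * gr v w.
    by rewrite -[LHS]opprK -gr_phi_skew phiv grZl mulNr.
  rewrite grZr grDr grNr grZr vp.
  have -> : gr v (phi (phi w)) = gr v w.
    by rewrite -[LHS]opprK -gr_phi_skew phiv grZl vp mulNr mulrN opprK mulrA l2 mul1r.
  rewrite mulrA mulrN l2 mulN1r opprK mulVf //.
  by apply: contra vw0 => /eqP H; apply/eqP; lra.
Qed.

Lemma gr_eigen X Y (l m : R) : phi X = l *~: X -> phi Y = m *~: Y ->
  l + m != 0 -> gr X Y = 0.
Proof.
move=> pX pY lm; have := gr_phi_skew X Y; rewrite pX pY grZl grZr => H.
apply/eqP; have : (l + m) * gr X Y == 0 by rewrite mulrDl H addNr.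
by rewrite mulf_eq0 (negPf lm).
Qed.

Lemma adapted_frame_exists sigma : sigma = 1 \/ sigma = -1 ->
  shape_normal_form sigma s nabla ->
  exists x v1 v2 v3 v4, adapted_frame sigma x v1 v2 v3 v4.
Proof.
move=> sg /(_ e)[U [V1 [V2 [eps [[oU Ue] eps1 /(_ e Ue)]]]]].
case=> [[V10 V20] pV1 pV2 V12 shp].
have [v1 H1 E1] := left_inv_extension V1.
have [v2 H2 E2] := left_inv_extension V2.
have m1E X : (-1) *~: X = - X.
  have -> : scst G (-1) = -1 by apply/smoothf_eqP.
  by rewrite scaleN1r.
have p1E X : 1 *~: X = X.
  have -> : scst G 1 = 1 by apply/smoothf_eqP.
  by rewrite scale1r.
have p1 : phi v1 = (-1) *~: v1.
  rewrite m1E; apply: left_inv_eq; [exact: left_inv_phi|exact: left_invN|].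
  by move=> f; rewrite -(phi_local s E1) pV1 !vfoppE E1.
have p2 : phi v2 = 1 *~: v2.
  rewrite p1E; apply: left_inv_eq => //; first exact: left_inv_phi.
  by move=> f; rewrite -(phi_local s E2) pV2 E2.
have v10 : v1 <> 0 by move=> v0; apply: V10 => f; rewrite E1 v0.
have v20 : v2 <> 0 by move=> v0; apply: V20 => f; rewrite E2 v0.
have [v3 [H3 p3 g13]] := dual_eigenvector H1 v10 (or_intror erefl) p1.
have [w [Hw pw g2w]] := dual_eigenvector H2 v20 (or_introl erefl) p2.
rewrite opprK in p3.
have n2 : -1 + -1 != 0 :> R by apply/eqP; lra.
have p22 : 1 + 1 != 0 :> R by apply/eqP; lra.
have g12 : gr v1 v2 = 0.
  by rewrite -(gr_local s _ E1) grC -(gr_local s _ E2) grC.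
pose v4 := w - gr v3 w *~: v1.
have p4 : phi v4 = (-1) *~: v4.
  by rewrite /v4 linearB linearZ /= pw p1 !m1E scalerN opprD.
have H4 : left_invariant v4 by apply: left_invD => //; apply: left_invN; exact: left_invZ.
have g34 : gr v3 v4 = 0 by rewrite grDr grNr grZr [gr v3 v1]grC g13 mulr1 subrr.
have g24 : gr v2 v4 = 1 by rewrite grDr grNr grZr [gr v2 v1]grC g12 mulr0 subr0.
have Hxi := left_inv_xi LI.
exists (eps *~: xi), v1, v2, v3, v4; split => //.
- by split => //; exact: left_invZ.
- by split; rewrite ?p1 ?p2 ?p3 ?p4 ?m1E ?p1E // linearZ /= phi_xi scaler0.
- by exists eps.
- rewrite grZl grZr /gr -etaE eta_xi smoothf1 mulr1.
  by case: eps1 => ->; ring.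
- exact: (gr_eigen p1 p1 n2).
- exact: (gr_eigen p1 p4 n2).
- exact: (gr_eigen p2 p2 p22).
- exact: (gr_eigen p2 p3 p22).
- exact: (gr_eigen p3 p3 p22).
- exact: (gr_eigen p4 p4 n2).
- move=> X HX; apply: left_inv_eq.
  + by apply: (left_inv_nabla LI LC HX); exact: left_invZ.
  + by apply: left_invN; apply: left_invD; exact: left_invZ.
  + move=> f; have := shp X f; rewrite (nablaZr LC) /shape.
    rewrite !vfoppE !vfaddE !vfscaleE !scstE vfaddE !vfscaleE scstE.
    rewrite E1 E2 -[g X V1 e]/(gr X V1) -[g X V2 e]/(gr X V2).
    rewrite ![gr X _]grC (gr_local s X E1) (gr_local s X E2).
    rewrite mulrA => H; rewrite -[nabla X xi f e]opprK H.
    by case: eps1 => ->; ring.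
Qed.

Section Brackets.
Variables (sigma : R) (x v1 v2 v3 v4 : X^oo(G)).
Hypothesis AF : adapted_frame sigma x v1 v2 v3 v4.

Lemma af_left_inv : [/\ left_invariant x, left_invariant v1, left_invariant v2,
  left_invariant v3 & left_invariant v4].
Proof. exact: af_inv AF. Qed.

Lemma leaf_tangent_v : [/\ leaf_tangent s v1, leaf_tangent s v2, leaf_tangent s v3
  & leaf_tangent s v4].
Proof.
have [_ p1 p2 p3 p4] := af_phi AF; rewrite /leaf_tangent.
split; [rewrite -[v1]opprK -p1|rewrite -p2|rewrite -p3|rewrite -[v4]opprK -p4];
  by rewrite ?[Defs.eta s (- _)]linearN eta_phi ?oppr0.
Qed.

Lemma gr_x_leaf Z : leaf_tangent s Z -> gr x Z = 0.
Proof.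
by have [r ->] := af_xi AF; move=> tZ; rewrite grZl /gr -etaE tZ mulr0.
Qed.

Lemma gramE : (gr x x = 1) *
  ((gr x v1 = 0) * (gr x v2 = 0) * (gr x v3 = 0) * (gr x v4 = 0)) *
  ((gr v1 x = 0) * (gr v2 x = 0) * (gr v3 x = 0) * (gr v4 x = 0)) *
  ((gr v1 v1 = 0) * (gr v1 v2 = 0) * (gr v1 v3 = 1) * (gr v1 v4 = 0)) *
  ((gr v2 v1 = 0) * (gr v2 v2 = 0) * (gr v2 v3 = 0) * (gr v2 v4 = 1)) *
  ((gr v3 v1 = 1) * (gr v3 v2 = 0) * (gr v3 v3 = 0) * (gr v3 v4 = 0)) *
  ((gr v4 v1 = 0) * (gr v4 v2 = 1) * (gr v4 v3 = 0) * (gr v4 v4 = 0)).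
Proof.
have [t1 t2 t3 t4] := leaf_tangent_v.
case: AF => _ _ _ _ gxx g11 g12 g13 g14 g22 g23 g24 g33 g34 g44 _.
by do !split; first [assumption | by rewrite gr_x_leaf | by rewrite grC | by rewrite grC gr_x_leaf].
Qed.

Definition frame : 5.-tuple X^oo(G) := [tuple x; v1; v2; v3; v4].

Lemma frame_left_inv i : left_invariant (tnth frame i).
Proof.
have [Hx H1 H2 H3 H4] := af_left_inv.
by case: i => -[|[|[|[|[|//]]]]] i; rewrite (tnth_nth 0) /=.
Qed.

Lemma frame_gram : (\matrix_(i, j) gr (tnth frame i) (tnth frame j) : 'M[R]_5) \in unitmx.
Proof.
set A := \matrix_(i, j) _.
suff /mulmx1_unit[] : A *m A = 1%:M by [].
apply/matrixP => i j; rewrite !mxE !big_ord_recl big_ord0 !mxE !(tnth_nth 0) /=.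
case: i => -[|[|[|[|[|//]]]]] i; case: j => -[|[|[|[|[|//]]]]] j;
  rewrite /= !gramE /=; ring.
Qed.

Lemma frame_basis : lie_algebra_basis frame.
Proof. exact: (gram_basis frame_left_inv frame_gram). Qed.

Lemma frame_ext X Y : left_invariant X -> left_invariant Y ->
  gr X x = gr Y x -> gr X v1 = gr Y v1 -> gr X v2 = gr Y v2 ->
  gr X v3 = gr Y v3 -> gr X v4 = gr Y v4 -> X = Y.
Proof.
move=> HX HY Ex E1 E2 E3 E4.
apply: (gram_separates frame_left_inv frame_gram HX HY).
by case=> -[|[|[|[|[|//]]]]] i; rewrite (tnth_nth 0).
Qed.

Lemma om_skew X Y Z : left_invariant Y -> left_invariant Z -> om X Y Z = - om X Z Y.
Proof. exact: (gr_nabla_skew LI LC). Qed.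

Lemma om_x X Z : left_invariant X ->
  om X x Z = - (gr X v1 * gr v1 Z + sigma * gr X v2 * gr v2 Z).
Proof. by move=> HX; rewrite /om (af_shape AF) // grNl grDl !grZl. Qed.

Lemma gr_lieb X Y Z : gr (lieb X Y) Z = om X Y Z - om Y X Z.
Proof. by rewrite -(nabla_torsion LC) grDl grNl. Qed.

Lemma om_leaf X : leaf_tangent s X -> om X v1 v4 = 0 /\ om X v2 v3 = 0.
Proof.
have [t1 t2 t3 t4] := leaf_tangent_v.
have [_ p1 p2 p3 p4] := af_phi AF => tX.
have /(congr1 (fun f : C^oo(G) => f e)) := para_kahler_nabla LC PKL tX t1 t4.
have /(congr1 (fun f : C^oo(G) => f e)) := para_kahler_nabla LC PKL tX t2 t3.
rewrite p1 p2 p3 p4 (nablaNr LC) metricNl metricNr !smoothfN.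
rewrite -[g _ v3 e]/(om X v2 v3) -[g _ v4 e]/(om X v1 v4); split; lra.
Qed.

Lemma dPhi_x Y Z : left_invariant Y -> left_invariant Z ->
  gr (lieb x Y) (phi Z) = gr (lieb x Z) (phi Y).
Proof.
move=> HY HZ; have [[_ dPhi] _] := WPC.
have [Hx _ _ _ _] := af_left_inv; have [px _ _ _ _] := af_phi AF.
have /(congr1 (fun f : C^oo(G) => f e)) := dPhi x Y Z.
have c V W : left_invariant V -> left_invariant W ->
    fundamental_form s V W = scst G (gr (phi V) W).
  by move=> HV HW; apply: (metric_left_inv LI) => //; exact: (left_inv_phi LI).
have skew V W : fundamental_form s V W e = - gr V (phi W).
  exact: gr_phi_skew.
have c0 (U V W : X^oo(G)) : left_invariant V -> left_invariant W ->
    U (fundamental_form s V W) = 0 by move=> HV HW; rewrite c // vf_scst.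
rewrite (c0 x Y Z) // (c0 Y Z x) // (c0 Z x Y) // !smoothfD !smoothfN !skew px smoothf0.
have -> : gr (lieb Y Z) 0 = 0 by rewrite grC gr0l.
by rewrite (lieb_anti Z) grNl; lra.
Qed.

Lemma om_x_leaf : om x v1 v4 = 0 /\ om x v2 v3 = 0.
Proof.
have [Hx H1 H2 H3 H4] := af_left_inv; have [_ p1 p2 p3 p4] := af_phi AF.
have := dPhi_x H1 H4; have := dPhi_x H2 H3.
rewrite p1 p2 p3 p4 !grNr !gr_lieb !om_x // !gramE.
rewrite (om_skew x H3 H2) (om_skew x H4 H1); split; lra.
Qed.

(* The leaf part of R(X, Y) x vanishes because phi annihilates R(X, Y) x. *)
Lemma codazzi X Y Z : left_invariant X -> left_invariant Y -> leaf_tangent s Z ->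
  gr Y v1 * om X v1 Z + sigma * gr Y v2 * om X v2 Z
  - (gr X v1 * om Y v1 Z + sigma * gr X v2 * om Y v2 Z) =
  (om X Y v1 - om Y X v1) * gr v1 Z + sigma * (om X Y v2 - om Y X v2) * gr v2 Z.
Proof.
move=> HX HY tZ; have [r xE] := af_xi AF.
have : gr (curvature nabla X Y x) Z = 0.
  have -> : curvature nabla X Y x = r *~: curvature nabla X Y xi.
    by rewrite /curvature xE !(nablaZr LC) !scalerBr.
  by rewrite grZl /gr (curvature_xi LC X Y WPC tZ) mulr0.
rewrite /curvature !(af_shape AF) //; last exact: left_inv_lieb.
rewrite !(nablaNr LC) !(nablaDr LC) !(nablaZr LC).
rewrite !(grDl, grNl, grZl) !gr_lieb /om => H.
lra.
Qed.

Lemma omXX X Y : left_invariant Y -> om X Y Y = 0.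
Proof. by move=> HY; have := om_skew X HY HY; lra. Qed.

Lemma om_v1v2 : [/\ om x v1 v2 = 0, om v1 v1 v2 = 0, om v2 v1 v2 = 0, om v3 v1 v2 = 0
  & om v4 v1 v2 = 0].
Proof.
have [Hx H1 H2 H3 H4] := af_left_inv; have [t1 t2 t3 t4] := leaf_tangent_v.
have z X : left_invariant X -> gr X v1 = 0 -> om X v1 v2 = 0.
  by move=> HX gX; have := codazzi HX H3 t2; rewrite gX !gramE !omXX //; lra.
split; try by apply: z => //; rewrite gramE.
have := codazzi H3 H4 t1; rewrite !gramE !omXX // (om_skew v3 H2 H1).
by case: (af_sigma AF) => ->; lra.
Qed.

Lemma om_v1v3 : [/\ om x v1 v3 = 0, om v1 v1 v3 = 0, om v2 v1 v3 = 0 & om v4 v1 v3 = 0].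
Proof.
have [Hx H1 H2 H3 H4] := af_left_inv; have [t1 t2 t3 t4] := leaf_tangent_v.
have [l14 l23] := om_leaf t3; have [_ _ _ z312 _] := om_v1v2.
have z X : left_invariant X -> gr X v1 = 0 -> om v3 X v1 = 0 -> om X v1 v3 = 0.
  move=> HX gX X1; have := codazzi HX H3 t3.
  by rewrite gX X1 l23 (om_skew X H3 H1) !gramE; lra.
split; apply: z => //; rewrite ?gramE ?omXX ?om_x ?gramE //.
- by rewrite !(mulr0, addr0) oppr0.
- by rewrite om_skew // z312 oppr0.
- by rewrite om_skew // l14 oppr0.
Qed.

Lemma om_v2v4 : [/\ om x v2 v4 = 0, om v1 v2 v4 = 0, om v2 v2 v4 = 0 & om v3 v2 v4 = 0].
Proof.
have [Hx H1 H2 H3 H4] := af_left_inv; have [t1 t2 t3 t4] := leaf_tangent_v.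
have [l14 l23] := om_leaf t4; have [_ _ _ _ z412] := om_v1v2.
have z X : left_invariant X -> gr X v2 = 0 -> om v4 X v2 = 0 -> om X v2 v4 = 0.
  move=> HX gX X2; have := codazzi HX H4 t4.
  rewrite gX X2 l14 (om_skew X H4 H2) !gramE.
  by case: (af_sigma AF) => ->; lra.
split; apply: z => //; rewrite ?gramE ?omXX ?om_x ?gramE //.
- by rewrite !(mulr0, mul0r, addr0) oppr0.
- by rewrite om_skew // l23 oppr0.
Qed.

Lemma om_row X : left_invariant X ->
  om X v1 v2 = 0 -> om X v1 v4 = 0 -> om X v2 v3 = 0 ->
  ((om X x x = 0) * (om X x v1 = 0) * (om X x v2 = 0) *
    (om X x v3 = - gr X v1) * (om X x v4 = - (sigma * gr X v2))) *
  ((om X v1 x = 0) * (om X v1 v1 = 0) * (om X v1 v2 = 0) * (om X v1 v4 = 0)) *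
  ((om X v2 x = 0) * (om X v2 v1 = 0) * (om X v2 v2 = 0) * (om X v2 v3 = 0)) *
  ((om X v3 x = gr X v1) * (om X v3 v1 = - om X v1 v3) * (om X v3 v2 = 0) *
    (om X v3 v3 = 0)) *
  ((om X v4 x = sigma * gr X v2) * (om X v4 v1 = 0) * (om X v4 v2 = - om X v2 v4) *
    (om X v4 v3 = - om X v3 v4) * (om X v4 v4 = 0)).
Proof.
move=> HX z12 z14 z23; have [Hx H1 H2 H3 H4] := af_left_inv.
have ox Z : om X x Z = - (gr X v1 * gr v1 Z + sigma * gr X v2 * gr v2 Z).
  exact: om_x.
rewrite !omXX //.
rewrite (om_skew X H1 Hx) (om_skew X H2 Hx) (om_skew X H3 Hx) (om_skew X H4 Hx).
rewrite (om_skew X H2 H1) (om_skew X H4 H1) (om_skew X H3 H2) z12 z14 z23 !ox !gramE.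
rewrite (om_skew X H3 H1) (om_skew X H4 H2) (om_skew X H4 H3).
by do !split; ring.
Qed.

Lemma frame_brackets :
  let a0 := om v3 v1 v3 in let b0 := om v4 v2 v4 in
  let m0 := om x v3 v4 in let m1 := om v1 v3 v4 in let m2 := om v2 v3 v4 in
  [/\ lieb x v1 = 0, lieb x v2 = 0, lieb x v3 = v1 + m0 *~: v2
    & lieb x v4 = (- m0) *~: v1 + sigma *~: v2] /\
  [/\ lieb v1 v2 = 0, lieb v1 v3 = (- a0) *~: v1 + m1 *~: v2
    & lieb v1 v4 = (- m1) *~: v1] /\
  [/\ lieb v2 v3 = m2 *~: v2, lieb v2 v4 = (- m2) *~: v1 + (- b0) *~: v2
    & lieb v3 v4 = (- om v3 v3 v4) *~: v1 - om v4 v3 v4 *~: v2].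
Proof.
move=> a0 b0 m0 m1 m2; have [Hx H1 H2 H3 H4] := af_left_inv.
have [t1 t2 t3 t4] := leaf_tangent_v.
have [zx z1 z2 z3 z4] := om_v1v2.
have [yx y1 y2 y4] := om_v1v3; have [wx w1 w2 w3] := om_v2v4.
have [lx lx'] := om_x_leaf; have [l1 l1'] := om_leaf t1.
have [l2 l2'] := om_leaf t2; have [l3 l3'] := om_leaf t3; have [l4 l4'] := om_leaf t4.
have rx := om_row Hx zx lx lx'; have r1 := om_row H1 z1 l1 l1'.
have r2 := om_row H2 z2 l2 l2'; have r3 := om_row H3 z3 l3 l3'.
have r4 := om_row H4 z4 l4 l4'.
split; [split|split; split]; apply: frame_ext;
  try (by apply: left_inv_lieb); try (exact: (@left_inv0 R 5 G));
  try (by repeat first [apply: left_invZ | apply: left_invD | apply: left_invN]);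
  rewrite gr_lieb ?(grDl, grNl, grZl, gr0l) ?gramE /a0 /b0 /m0 /m1 /m2
    ?(rx, r1, r2, r3, r4, yx, y1, y2, y4, wx, w1, w2, w3) ?gramE; ring.
Qed.

End Brackets.
End Adapted_frame.

Lemma liebXX (R : realType) n (M : manifold R n) (X : X^oo(M)) : lieb X X = 0.
Proof. by apply/vf_eqP => f p; rewrite liebE subrr. Qed.

Section Classification.
Variables (R : realType) (G : lieGroup R 5) (s : apcm G).
Variable nabla : X^oo(G) -> X^oo(G) -> X^oo(G).
Hypotheses (LI : left_invariant_structure s) (LC : levi_civita (metric s) nabla).
Hypothesis WPC : weakly_para_cosymplectic s nabla.
Hypothesis PKL : para_kahler_leaves s.
Variables (sigma : R) (x v1 v2 v3 v4 : X^oo(G)).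
Hypothesis AF : adapted_frame s nabla sigma x v1 v2 v3 v4.
Notation om := (om s nabla).
Notation gr := (gr s).

Lemma frame_jacobi :
  let a0 := om v3 v1 v3 in let b0 := om v4 v2 v4 in
  let m0 := om x v3 v4 in let m1 := om v1 v3 v4 in let m2 := om v2 v3 v4 in
  [/\ m1 * m2 = 0, m1 * (m1 - b0) = 0, m2 * (m2 + a0) = 0,
      m1 + m0 * m2 + m0 * a0 = 0 & m0 * m1 - m0 * b0 - sigma * m2 = 0].
Proof.
move=> a0 b0 m0 m1 m2.
have [[x1 x2 x3 x4] [[b12 b13 b14] [b23 b24 b34]]] := frame_brackets LI LC WPC PKL AF.
have b21 : lieb v2 v1 = 0 by rewrite lieb_anti b12 oppr0.
have GE := gramE AF.
have prj (W : X^oo(G)) : W = 0 -> gr W v3 = 0 /\ gr W v4 = 0.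
  by move->; rewrite !gr0l.
have /prj[A1 A2] := jacobi v1 v3 v4.
have /prj[B1 B2] := jacobi v2 v3 v4.
have /prj[C1 C2] := jacobi x v3 v4.
move: A1 A2 B1 B2 C1 C2.
rewrite (lieb_anti v4 v1) (lieb_anti v4 v2) (lieb_anti v4 x).
rewrite x3 x4 b13 b14 b23 b24 b34.
rewrite ?(liebDl, liebNl, liebZl, liebXX).
rewrite ?(lieb_anti v1 x, lieb_anti v2 x) x1 x2 ?(b12, b13, b14, b21, b23, b24).
rewrite ?(grDl, grNl, grZl, gr0l) ?(GE, gr0l).
rewrite -/a0 -/b0 -/m0 -/m1 -/m2 => A1 A2 B1 B2 C1 C2.
split; lra.
Qed.

Lemma frame_classification : class1 G \/ class2 G \/ class3 G \/ class4 G.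
Proof.
have [[x1 x2 x3 x4] [[b12 b13 b14] [b23 b24 b34]]] := frame_brackets LI LC WPC PKL AF.
have := frame_jacobi.
set a0 := om v3 v1 v3 in b13 *; set b0 := om v4 v2 v4 in b24 *.
set m0 := om x v3 v4 in x3 x4 *; set m1 := om v1 v3 v4 in b13 b14 *.
set m2 := om v2 v3 v4 in b23 b24 *.
move=> /= [J1 J2 J3 J4 J5].
have B := frame_basis AF; have sg := af_sigma AF.
have sN r (X : X^oo(G)) : - (r *~: X) = (- r) *~: X.
  by rewrite -scaleNr; congr (_ *: _); apply/smoothf_eqP.
have s0 (X : X^oo(G)) : 0 *~: X = 0.
  have -> : scst G 0 = 0 by apply/smoothf_eqP.
  exact: scale0r.
have [m20|m20] := eqVneq m2 0; last first.
  have m10 : m1 = 0 by move/eqP: J1; rewrite mulf_eq0 (negPf m20) orbF => /eqP.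
  have m2E : m2 = - a0.
    by move/eqP: J3; rewrite mulf_eq0 (negPf m20) /= addr_eq0 => /eqP.
  have a00 : a0 != 0 by rewrite -oppr_eq0 -m2E.
  have mb : m0 * b0 = sigma * a0 by move: J5; rewrite m10 m2E; lra.
  have b00 : b0 != 0.
    apply: contra a00 => /eqP b00; move: mb; rewrite b00 mulr0 => /esym/eqP.
    by rewrite mulf_eq0; case: sg => ->; rewrite ?oppr_eq0 oner_eq0.
  have m0E : m0 = sigma * (a0 / b0) by rewrite mulrA -mb mulfK.
  left; exists x, v1, v2, v3, v4, sigma, a0, b0, (om v3 v3 v4), (om v4 v3 v4).
  split => //; split; first exact: B.
  split; last split; split => //.
  + by rewrite x3 m0E.
  + by rewrite x4 m0E.
  + by rewrite b13 m10 s0 addr0.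
  + by rewrite b14 m10 oppr0 s0.
  + by rewrite b23 m2E.
  + by rewrite b24 m2E opprK -sN.
have [m10|m10] := eqVneq m1 0; last first.
  have m1E : m1 = b0.
    by move/eqP: J2; rewrite mulf_eq0 (negPf m10) /= subr_eq0 => /eqP.
  have b00 : b0 != 0 by rewrite -m1E.
  have ma : m0 * a0 = - b0 by move: J4; rewrite m1E m20; lra.
  have a00 : a0 != 0.
    by apply: contra b00 => /eqP a00; move: ma; rewrite a00 mulr0 -oppr_eq0 => <-.
  have m0E : m0 = - (b0 / a0) by rewrite -mulNr -ma mulfK.
  right; left; exists x, v1, v2, v3, v4, sigma, a0, b0, (om v3 v3 v4), (om v4 v3 v4).
  split => //; split; first exact: B.
  split; last split; split => //.
  + by rewrite x3 m0E -sN.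
  + by rewrite x4 m0E opprK.
  + by rewrite b13 m1E.
  + by rewrite b14 m1E.
  + by rewrite b23 m20 s0.
  + by rewrite b24 m20 oppr0 s0 add0r.
have [m00|m00] := eqVneq m0 0.
  do 2 right; left.
  exists x, v1, v2, v3, v4, sigma, a0, b0, (om v3 v3 v4), (om v4 v3 v4).
  split => //; split; first exact: B.
  split; last split; split => //.
  + by rewrite x3 m00 s0 addr0.
  + by rewrite x4 m00 oppr0 s0 add0r.
  + by rewrite b13 m10 s0 addr0.
  + by rewrite b14 m10 oppr0 s0.
  + by rewrite b23 m20 s0.
  + by rewrite b24 m20 oppr0 s0 add0r.
have a00 : a0 = 0.
  apply/eqP; have : m0 * a0 == 0 by apply/eqP; move: J4; rewrite m10 m20; lra.
  by rewrite mulf_eq0 (negPf m00).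
have b00 : b0 = 0.
  apply/eqP; have : m0 * b0 == 0 by apply/eqP; move: J5; rewrite m10 m20; lra.
  by rewrite mulf_eq0 (negPf m00).
do 3 right; exists x, v1, v2, v3, v4, sigma, m0, (om v3 v3 v4), (om v4 v3 v4).
split => //; split; first exact: B.
split; last split; split => //.
+ by rewrite b13 m10 a00 oppr0 !s0 addr0.
+ by rewrite b14 m10 oppr0 s0.
+ by rewrite b23 m20 s0.
+ by rewrite b24 m20 b00 oppr0 !s0 addr0.
Qed.

End Classification.

Theorem theorem9 (R : realType) (G : lieGroup R 5) (s : apcm G)
    (nabla : vfield G -> vfield G -> vfield G) :
  left_invariant_structure s ->
  levi_civita (metric s) nabla ->
  weakly_para_cosymplectic s nabla ->
  para_kahler_leaves s ->
  hyperbolic s nabla \/ elliptic s nabla ->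
  class1 G \/ class2 G \/ class3 G \/ class4 G.
Proof.
move=> LI LC WPC PKL hyp.
have [sigma [sg [x [v1 [v2 [v3 [v4 AF]]]]]]] :
    exists sigma : R, (sigma = 1 \/ sigma = -1) /\
      exists x v1 v2 v3 v4, adapted_frame s nabla sigma x v1 v2 v3 v4.
  by case: hyp => snf; [exists (-1) | exists 1];
    (split; [|apply: (adapted_frame_exists LI LC) snf]; by [left|right]).
exact: (frame_classification LI LC WPC PKL AF).
Qed.
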